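(* Let $n\ge1$, let $t\in\mathrm{PT}_n$ be a tree and let $\omega=(\omega_1,\dots,\omega_n)\in\mathbb{Z}_{>0}^n$ be a weight. The Loday realization of the operahedron $P_{(t,\omega)}\subset\mathbb{R}^{n-1}$ satisfies: (1) It is contained in the hyperplane with equation $\displaystyle\sum_{i\in E(t)}x_i=\sum_{k,\ell\in V(t),\,k<\ell}\omega_k\omega_\ell$. (2) Let $N$ be a non-trivial nest of $t$. For any maximal nesting $\mathcal{N}$ of $t$, the point $M(t,\mathcal{N},\omega)$ lies in the half-space $\displaystyle\sum_{i\in E(t(N))}x_i\ge\sum_{k,\ell\in V(t(N)),\,k<\ell}\omega_k\omega_\ell$, with equality if and only if $N\in\mathcal{N}$. (3) $P_{(t,\omega)}$ is the intersection of the hyperplane of (1) and of the half-spaces of (2). (4) The face lattice $(\mathcal{L}(P_{(t,\omega)}),\subset)$ is isomorphic to the dual of the lattice of nestings of $t$. (5) Any face of a Loday realization of an operahedron is isomorphic to a product of Loday realizations of operahedra of lower dimension, via a permutation of coordinates.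
   Context: $\mathrm{PT}_n$ is the set of planar rooted trees with $n$ internal vertices, each internal vertex having at least one input. ''Vertices'' $V(t)$ and ''edges'' $E(t)$ always mean internal vertices and internal edges, so $|E(t)|=n-1$; leaves and the root edge are not counted. Starting from the root, walk around the tree clockwise, numbering each vertex (resp. edge) the first time it is met; thus $V(t)=\{1,\dots,n\}$ and $E(t)=\{1,\dots,n-1\}$. A nest of $t$ is a nonempty set $N\subset E(t)$ such that the graph formed by the edges of $N$ and their adjacent vertices is connected. The induced subtree $t(N)$ has as vertices the vertices adjacent to an edge of $N$, as internal edges $E(t(N))=N$, and all other edges, leaves or root of $t$ incident to these vertices become leaves or the root of $t(N)$. The trivial nest is $E(t)$. A nesting of $t$ is a set $\mathcal{N}$ of nests such that (a) $E(t)\in\mathcal{N}$; (b) any two distinct nests in $\mathcal{N}$ are either strictly included one in the other or disjoint; (c) if $N_i,N_j\in\mathcal{N}$ are disjoint then no edge of $N_i$ is adjacent to an edge of $N_j$. For a corolla ($n=1$) the set of nestings is empty. The lattice of nestings of $t$ is the set of nestings of $t$ ordered by inclusion, together with a maximal element. A nesting is maximal if it has maximal cardinality, namely $n-1$. For an edge $e$, the nests of $\mathcal{N}$ containing $e$ are totally ordered by inclusion; the smallest is denoted $\min\mathcal{N}(e)$. For a maximal nesting $\mathcal{N}$ and an edge $i$, cut the tree $t(\min\mathcal{N}(i))$ at $i$ into two subtrees: $t_1$, having $i$ as its root, and $t_2$, having $i$ as a leaf. Put $\alpha_i=\sum_{j\in V(t_1)}\omega_j$, $\beta_i=\sum_{j\in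 V(t_2)}\omega_j$ and $M(t,\mathcal{N},\omega)=(\alpha_1\beta_1,\dots,\alpha_{n-1}\beta_{n-1})\in\mathbb{Z}^{n-1}$. The Loday realization of weight $\omega$ of the operahedron associated to $t$ is $P_{(t,\omega)}=\operatorname{conv}\{M(t,\mathcal{N},\omega):\mathcal{N}\text{ a maximal nesting of }t\}\subset\mathbb{R}^{n-1}$. For $n=1$, by convention, $P_{(t,\omega)}$ is one point in $0$-dimensional space.
   Formalization: For the corolla the empty set counts as its unique nesting (with no nesting, (4) fails for a point); in (5) faces are nonempty, and ''of lower dimension'' is required only of faces other than the whole polytope (a pentagon is no such product). *)

(* Defs.v *)
From mathcomp Require Import all_boot all_order all_algebra.

Set Implicit Arguments.
Unset Strict Implicit.
Unset Printing Implicit Defensive.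

Import Order.TTheory GRing.Theory Num.Theory.

(* A tree has n.+1 internal vertices, hence n internal edges: its vertices are *)
(* 'I_n.+1 and its edges 'I_n, both numbered from 0.                           *)

(* [Node s l] is an internal vertex whose inputs are, from left to right, the  *)
(* elements of s :: l, so every internal vertex has at least one input.        *)
Inductive ptree : Type :=
| Leaf
| Node of ptree & seq ptree.

Fixpoint nvert (t : ptree) : nat :=
  if t is Node s l then (nvert s + sumn (map nvert l)).+1 else 0.

Definition PT (n : nat) : Type := {t : ptree | nvert t == n}.

(* An internal vertex is located by the sequence of input positions followed   *)
(* from the root. Walking clockwise around t, with the root at the bottom and  *)
(* inputs read from left to right, meets the vertices in prefix order.         *)
Fixpoint vaddr (t : ptree) : seq (seq nat) :=
  if t is Node s l then
    let inputs := vaddr s :: map vaddr l in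
    [::] :: flatten [seq map (cons p.1) p.2
                    | p <- zip (iota 0 (size inputs)) inputs]
  else [::].

Definition parent (t : ptree) (v : nat) : nat :=
  let a := nth [::] (vaddr t) v in index (take (size a).-1 a) (vaddr t).

Section Combinatorics.
Variables (n : nat) (t : PT n.+1).
Implicit Types (i j : 'I_n) (u v : 'I_n.+1) (N : {set 'I_n})
  (NN : {set {set 'I_n}}).

(* The walk meets the edge above a vertex just before the vertex itself, so    *)
(* edge i joins vertex i.+1 to its parent. [parent] is always in range, so     *)
(* [inord] never falls back on its default.                                    *)
Definition upper i : 'I_n.+1 := lift ord0 i.
Definition lower i : 'I_n.+1 := inord (parent (val t) (upper i)).

Definition incident v i : bool := (v == upper i) || (v == lower i).

Definition adjacent i j : bool :=
  (i != j) && [exists v, incident v i && incident v j].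

(* The set V(t(N)). *)
Definition nest_verts N : {set 'I_n.+1} :=
  [set v | [exists i in N, incident v i]].

Definition linked N : rel 'I_n.+1 :=
  [rel u v | [exists i in N, incident u i && incident v i]].

Definition nest N : bool :=
  (N != set0) &&
  [forall u in nest_verts N, forall v in nest_verts N, connect (linked N) u v].

Definition nontrivial_nest N : bool := nest N && (N != [set: 'I_n]).

(* The guard [0 < n] only matters for the corolla, which has no nest: its      *)
(* unique nesting is then the empty one, of maximal cardinality n = 0. Without *)
(* it the corolla would have no nesting at all, and its lattice of nestings    *)
(* one element instead of the two faces of a point.                            *)
Definition nesting NN : bool :=
  [&& [forall N in NN, nest N],
      (0 < n) ==> ([set: 'I_n] \in NN),
      [forall N1 in NN, forall N2 in NN, (N1 != N2) ==>
         [|| N1 \proper N2, N2 \proper N1 | [disjoint N1 & N2]]]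
    & [forall N1 in NN, forall N2 in NN, [disjoint N1 & N2] ==>
         [forall i in N1, forall j in N2, ~~ adjacent i j]]].

Definition maximal_nesting NN : bool := nesting NN && (#|NN| == n).

(* The nests of NN containing i form a chain: the smallest is their            *)
(* intersection.                                                               *)
Definition min_nest NN i : {set 'I_n} := \bigcap_(N in NN | i \in N) N.

(* Removing the edge i from t(N) leaves two connected components: the one of   *)
(* the upper end of i is the subtree having i as its root, the one of the      *)
(* lower end of i is the subtree having i as a leaf.                           *)
Definition cut_above N i : {set 'I_n.+1} :=
  [set u | connect (linked (N :\ i)) (upper i) u].
Definition cut_below N i : {set 'I_n.+1} :=
  [set u | connect (linked (N :\ i)) (lower i) u].

(* Nestings together with a maximal element, [None]. *)
Definition nesting_lattice : Type := option {NN : {set {set 'I_n}} | nesting NN}.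

Definition nesting_le (x y : nesting_lattice) : bool :=
  match x, y with
  | _, None => true
  | None, Some _ => false
  | Some NN1, Some NN2 => val NN1 \subset val NN2
  end.

Local Open Scope ring_scope.

Variable w : 'I_n.+1 -> int.

Definition nesting_vector NN : 'rV[int]_n :=
  \row_i ((\sum_(v in cut_above (min_nest NN i) i) w v) *
          (\sum_(v in cut_below (min_nest NN i) i) w v)).

Definition pairs_weight (V : {set 'I_n.+1}) : int :=
  \sum_(k in V) \sum_(l in V | (k < l)%N) w k * w l.

End Combinatorics.

From mathcomp Require Import all_classical all_reals.

Local Open Scope classical_set_scope.
Local Open Scope ring_scope.

Section Polytopes.
Variables (R : realType) (m : nat).
Implicit Types (S P F : set 'rV[R]_m).

Definition conv_hull S : set 'rV[R]_m :=
  [set x | exists (k : nat) (p : 'I_k -> 'rV[R]_m) (a : 'I_k -> R),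
     [/\ forall i, S (p i), forall i, 0 <= a i, \sum_i a i = 1
       & x = \sum_i a i *: p i]].

Definition dotp (c x : 'rV[R]_m) : R := \sum_i c 0 i * x 0 i.

(* The empty set and P itself are faces of P (take c = 0). *)
Definition face P F : Prop :=
  exists (c : 'rV[R]_m) (d : R),
    (forall x, P x -> dotp c x <= d) /\ F = [set x | P x /\ dotp c x = d].

(* The largest d such that S contains d.+1 affinely independent points. *)
Definition affdim S : nat :=
  \max_(d < m.+1 | `[< exists p : 'I_d.+1 -> 'rV[R]_m,
      (forall i, S (p i)) /\
      row_free (\matrix_(i < d) (p (lift ord0 i) - p ord0)) >]) d.

End Polytopes.

Section Loday.
Variables (R : realType) (n : nat) (t : PT n.+1) (w : 'I_n.+1 -> int).

Definition nesting_point (NN : {set {set 'I_n}}) : 'rV[R]_n :=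
  map_mx intr (nesting_vector t w NN).

Definition loday : set 'rV[R]_n :=
  conv_hull [set nesting_point NN | NN in [set NN | maximal_nesting t NN]].

Definition hyperplane : set 'rV[R]_n :=
  [set x : 'rV[R]_n | \sum_i x 0 i = (pairs_weight w [set: 'I_n.+1]%SET)%:~R].

Definition halfspace (N : {set 'I_n}) : set 'rV[R]_n :=
  [set x : 'rV[R]_n | (pairs_weight w (nest_verts t N))%:~R <= \sum_(i in N) x 0 i].

Definition boundary (N : {set 'I_n}) : set 'rV[R]_n :=
  [set x : 'rV[R]_n | \sum_(i in N) x 0 i = (pairs_weight w (nest_verts t N))%:~R].

End Loday.

Arguments nesting_point R {n} t w NN.
Arguments loday R {n} t w.
Arguments hyperplane R {n} w.
Arguments halfspace R {n} t w N.
Arguments boundary R {n} t w N.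

(* The product of the polytopes P j of R^(m j), seen in R^n through the        *)
(* bijection s from the coordinates of all the factors to 'I_n.                *)
Definition permuted_product (R : realType) (n k : nat) (m : 'I_k -> nat)
    (s : {j : 'I_k & 'I_(m j)} -> 'I_n)
    (P : forall j, set 'rV[R]_(m j)) : set 'rV[R]_n :=
  [set x : 'rV[R]_n | forall j, P j (\row_e x 0 (s (existT _ j e)))].

(* Main.v *)
(* For a map c from edges to integers, the connected components of the        *)
(* sublevel sets of c form a nesting, the level nesting of c. Every nesting is *)
(* the level nesting of minus its depth function, and the maximal nestings are *)
(* the level nestings of injective maps; breaking ties extends any nesting to  *)
(* a maximal one.                                                              *)
(*   Twice the coordinate i of the point of the level nesting of c is the sum  *)
(* of w u * w v over the ordered pairs of vertices whose path has i as its edge *)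
(* of highest level. Hence twice the sum of the coordinates in a set S of edges *)
(* is at least the total weight of the paths contained in S, with equality if  *)
(* and only if every path whose highest edge is in S is contained in S. This   *)
(* gives (1) and (2), for arbitrary S instead of nests.                        *)
(*   The weight of the paths contained in S is supermodular in S, so the nests *)
(* whose inequality is tight at a point x of the polyhedron of (3) form a      *)
(* nesting. Extending it to a maximal nesting and following the ray from the   *)
(* corresponding vertex through x until a new inequality becomes tight shows,  *)
(* by induction, that x is a convex combination of vertices. A face is the     *)
(* locus where the nests tight at one of its points in general position are    *)
(* tight; this is (4).                                                         *)
(*   On the face of a nesting NN, the inequalities split according to the      *)
(* smallest nest of NN containing each edge: a nest N contributes the Loday    *)
(* polytope of t(N) with the smaller nests of NN contracted, the weights of    *)
(* identified vertices being added. This is (5).                               *)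
Require Import Defs.
From mathcomp Require Import all_boot all_order all_algebra.
From mathcomp Require Import zify ring lra.

Set Implicit Arguments.
Unset Strict Implicit.
Unset Printing Implicit Defensive.

Import Order.TTheory GRing.Theory Num.Theory.

(** * Paths in a planar tree *)

(** The polytope is the base polytope of the set function [path_weight], the total weight of the
    ordered pairs of distinct vertices whose path stays in a given set of edges. A path inside one
    of two sets is inside their union, so this function is supermodular, strictly so when some path
    of the union is contained in neither set ([path_weight_supermodular_lt]). On a nest it is twice
    the right-hand side of the half-space ([path_weight_nest]).

    A maximal nesting comes from an injective level function ([maximal_nestingP]), and each pair of
    vertices is spent on the highest edge of its path, the first one to be cut
    ([nesting_vector_level]). Counting the pairs whose highest edge lies in [S] gives the
    hyperplane, the inequalities and their equality cases ([level_vector_total], [level_vector_ge],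
    [level_vector_gt]).

    Conversely, strict supermodularity uncrosses the nests tight at a point, which therefore form a
    nesting ([nesting_tight_nests]); moving away from a vertex where they are all tight ([ray_exit])
    puts every solution of the inequalities in the hull ([nest_ineqs_loday]). A face is determined
    by the nests tight at a generic point of it ([loday_face_tight]), and a nest outside a nesting
    is avoided by some maximal extension ([maximal_nesting_avoid]), so inclusion of faces reverses
    inclusion of nestings.

    On a face the set function splits into contractions, one for each nest
    ([layer_ineqs_tight_face]), and each of them is the function of a contracted tree with added
    weights ([tree_contraction], [path_weight_contraction]); hence the product
    ([tight_face_product]). The factors of a proper face have smaller dimension because a point off
    the face is affinely independent of it ([affdim_face_lt]). *)

Fixpoint ptree_nested_ind (P : ptree -> Prop) (PLeaf : P Leaf)
    (PNode : forall s l, P s -> foldr (fun u => and (P u)) True l -> P (Node s l))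
    (t : ptree) : P t :=
  match t with
  | Leaf => PLeaf
  | Node s l => PNode s l (ptree_nested_ind PLeaf PNode s)
      ((fix all_ind l := match l return foldr (fun u => and (P u)) True l with
        | [::] => I
        | u :: l' => conj (ptree_nested_ind PLeaf PNode u) (all_ind l')
        end) l)
  end.

(** The tail of [vaddr], with the first input position generalized to [k] for induction on the list
    of inputs. *)
Definition input_addrs k (inputs : seq (seq (seq nat))) : seq (seq nat) :=
  flatten [seq map (cons p.1) p.2 | p <- zip (iota k (size inputs)) inputs].

(** In prefix order a parent comes before its children; [seen] accumulates the addresses already
    met. *)
Fixpoint prefix_closed (seen L : seq (seq nat)) : bool :=
  if L is a :: L' then
    ((a == [::]) || (take (size a).-1 a \in seen)) &&
      prefix_closed (rcons seen a) L'
  else true.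

Lemma prefix_closed_cat seen L1 L2 :
  prefix_closed seen (L1 ++ L2) =
  prefix_closed seen L1 && prefix_closed (seen ++ L1) L2.
Proof.
elim: L1 seen => [|a L1 IH] seen /=; first by rewrite cats0.
by rewrite IH cat_rcons andbA.
Qed.

Lemma prefix_closed_map_cons k seen0 seen L :
  [::] \in seen -> {subset map (cons k) seen0 <= seen} ->
  prefix_closed seen0 L -> prefix_closed seen (map (cons k) L).
Proof.
elim: L seen0 seen => //= a L IH seen0 seen nil_seen sub; case/andP=> a_ok L_ok.
apply/andP; split; last first.
  apply: (IH (rcons seen0 a)) => //; first by rewrite mem_rcons inE nil_seen orbT.
  by move=> x; rewrite map_rcons !mem_rcons !inE => /orP[->//|/sub->]; rewrite orbT.
case: a a_ok {L_ok} => [|b a] /=; first by rewrite nil_seen.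
by move=> a_ok; apply: sub; apply: map_f.
Qed.

Lemma prefix_closed_input_addrs k seen inputs : [::] \in seen ->
  foldr (fun L => and (prefix_closed [::] L)) True inputs ->
  prefix_closed seen (input_addrs k inputs).
Proof.
elim: inputs k seen => //= L inputs IH k seen nil_seen [L_ok inputs_ok].
rewrite /input_addrs /= prefix_closed_cat (prefix_closed_map_cons _ _ L_ok) //=.
by apply: IH; rewrite // mem_cat nil_seen.
Qed.

Lemma prefix_closed_vaddr t : prefix_closed [::] (vaddr t).
Proof.
elim/ptree_nested_ind: t => //= s l IHs IHl.
apply: (@prefix_closed_input_addrs 0 [:: [::]] (vaddr s :: map vaddr l)) => //=.
by split=> //; elim: l IHl => //= u l IH [u_ok /IH].
Qed.

Lemma prefix_closed_nth seen L v : prefix_closed seen L ->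
  nth [::] L v != [::] ->
  take (size (nth [::] L v)).-1 (nth [::] L v) \in seen ++ take v L.
Proof.
elim: L seen v => [|a L IH] seen v /=; first by rewrite nth_nil.
case/andP=> a_ok L_ok; case: v => [|v] /=.
  by move=> /negPf a_neq; rewrite a_neq /= in a_ok; rewrite cats0.
by move=> /(IH _ _ L_ok); rewrite cat_rcons.
Qed.

Lemma parent_lt t v : 0 < v -> parent t v < v.
Proof.
move=> v_gt0; rewrite /parent.
(* The address [[::]], also the default out of range, yields index 0. *)
have [->|v_neq] := eqVneq (nth [::] (vaddr t) v) [::].
  by case: t => [|s l] //=; rewrite take_nil.
have := prefix_closed_nth (prefix_closed_vaddr t) v_neq.
set b := take _ _ => /= b_in; rewrite -[vaddr t](cat_take_drop v) index_cat b_in.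
by apply: leq_trans (geq_minl v (size (vaddr t))); rewrite -size_take_min index_mem.
Qed.

Section Separation.
Variables (n : nat) (t : PT n.+1).
Implicit Types (g i j e : 'I_n) (u v x : 'I_n.+1) (N S : {set 'I_n})
  (NN : {set {set 'I_n}}).

Lemma val_upper i : upper i = i.+1 :> nat. Proof. exact: lift0. Qed.

Lemma lower_le i : lower t i <= i.
Proof.
have lt_i : parent (val t) (upper i) < (upper i) by apply: parent_lt;
  rewrite val_upper.
have lt_n : parent (val t) (upper i) < n.+1 by exact: ltn_trans lt_i (ltn_ord _).
by rewrite /lower inordK // -ltnS -[X in _ < X]val_upper.
Qed.

Lemma vertexP v : v = ord0 \/ exists i, v = upper i.
Proof. by case: (unliftP ord0 v) => [i ->|->]; [right; exists i|left]. Qed.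

Lemma upper_inj : injective (@upper n). Proof. exact: lift_inj. Qed.

(** The parent map, made total by fixing the root, so that going down the tree is iteration. *)
Definition pred_vertex v : 'I_n.+1 :=
  if unlift ord0 v is Some i then lower t i else ord0.

(** Going down from [v] crosses [g]: [v] lies in the subtree with root edge [g]. *)
Definition above g v : bool := fconnect pred_vertex v (upper g).

Lemma above0 g : above g ord0 = false.
Proof.
apply/negP => /iter_findex; rewrite /pred_vertex.
set f := (X in findex X); have f0 : f ord0 = ord0 by rewrite /f unlift_none.
by rewrite iter_fix //; exact/eqP/neq_lift.
Qed.

Lemma above_upper g i : above g (upper i) = (i == g) || above g (lower t i).
Proof.
by rewrite /above fconnect_eqVf (inj_eq upper_inj) /pred_vertex liftK.
Qed.

Lemma above_gt g v : above g v -> g < v.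
Proof.
have [k] := ubnP (v : nat); elim: k v => // k IH v.
case: (vertexP v) => [->|[i ->]]; first by rewrite above0.
rewrite val_upper ltnS => lt_ik; rewrite above_upper => /orP[/eqP->//|ab].
have := lower_le i; have := IH _ _ ab; lia.
Qed.

(* The path from u to v consists of the edges that separate u from v. *)
Definition sep u v : {set 'I_n} := [set g | above g u != above g v].

Lemma in_sep g u v : (g \in sep u v) = (above g u != above g v).
Proof. by rewrite inE. Qed.

Lemma sepC u v : sep u v = sep v u.
Proof. by apply/setP=> g; rewrite !in_sep eq_sym. Qed.

Lemma sepxx u : sep u u = set0.
Proof. by apply/setP=> g; rewrite in_sep eqxx inE. Qed.

Lemma sep_trans x u v S : sep u x \subset S -> sep x v \subset S ->
  sep u v \subset S.
Proof.
move=> /subsetP uxS /subsetP xvS; apply/subsetP=> g; rewrite in_sep => g_uv.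
have [gux|gux] := eqVneq (above g u) (above g x); last by apply: uxS;
  rewrite in_sep.
by apply: xvS; rewrite in_sep -gux.
Qed.

Lemma sep_edge i : sep (upper i) (lower t i) = [set i].
Proof.
apply/setP=> g; rewrite in_sep inE above_upper [i == g]eq_sym.
case: (g =P i) => [<-|_] /=; last by rewrite eqxx.
suff /negPf-> : ~~ above g (lower t g) by [].
by apply/negP=> /above_gt; have := lower_le g; lia.
Qed.

Lemma incident_sep u v i : incident t u i -> incident t v i ->
  sep u v \subset [set i].
Proof.
by move=> /orP[]/eqP-> /orP[]/eqP->;
  rewrite ?sepxx ?sub0set // ?sep_edge // sepC sep_edge.
Qed.

(** Crossing an edge of [S] changes the side of that edge only. For the converse, replace the larger
    endpoint by its parent: the edge crossed lies on the path, because the vertices above an edge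
    have larger numbers than it, and the sum of the endpoints drops. *)
Lemma connect_linked S u v : connect (linked t S) u v = (sep u v \subset S).
Proof.
apply/idP/idP.
  case/connectP=> p; elim: p u v => [|x p IH] u v /= => [_ ->|].
    by rewrite sepxx sub0set.
  case/andP=> /existsP[i /and3P[iS ui xi]] xp def_v.
  apply: (@sep_trans x); last exact: IH.
  by apply: subset_trans (incident_sep ui xi) _; rewrite sub1set.
have linkC : symmetric (linked t S).
  by move=> a b; apply: eq_existsb => i; rewrite [incident t a i && _]andbC.
have cC := sym_connect_sym linkC.
have [k] := ubnP (u + v); elim: k u v => // k IH u v; rewrite ltnS => le_k.
have [->|neq_uv] := eqVneq u v; first by rewrite connect0.
wlog lt_uv : u v le_k neq_uv / v < u.
  move=> W uvS; have := neq_uv; rewrite -val_eqE /= neq_ltn => /orP[lt|lt];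
    last exact: W.
  by rewrite cC; apply: W; rewrite // 1?addnC 1?eq_sym // sepC.
have [u0|[i def_u]] := vertexP u; first by rewrite u0 in lt_uv.
move=> uvS; have lt_i : v <= i by rewrite def_u val_upper in lt_uv.
have iS : i \in S.
  apply: (subsetP uvS); rewrite in_sep def_u above_upper eqxx /=.
  by suff /negPf-> : ~~ above i v by []; apply/negP=> /above_gt; lia.
apply: (@connect_trans _ _ (lower t i)).
  by apply: connect1; apply/existsP; exists i;
    rewrite iS /incident def_u !eqxx orbT.
apply: IH; first by have := lower_le i; move: le_k; rewrite def_u val_upper; lia.
apply: (sep_trans _ uvS); rewrite def_u sepC sep_edge sub1set //.
Qed.

Lemma sep_eq0 u v : (sep u v == set0) = (u == v).
Proof.
apply/idP/eqP => [|->]; last by rewrite sepxx.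
rewrite -subset0 -connect_linked => /connectP[[|x p] //= /andP[]].
by case/existsP=> i; rewrite inE.
Qed.

(** If [z] could not be reached from [x] inside the path, no walk from [x] inside it would use [i],
    since either end of [i] is linked to [z]; yet a walk from [x] to [v] must cross [i]. *)
Lemma sep_convex x v z i : i \in sep x v -> incident t z i ->
  sep x z \subset sep x v.
Proof.
set S := sep x v => iS zi; rewrite -connect_linked; apply: contraTT iS => z_far.
have : connect (linked t S) x v by rewrite connect_linked.
suff W y : connect (linked t S) x y -> connect (linked t (S :\ i)) x y.
  by move/W; rewrite connect_linked => /subsetP/(_ i)/contraNN; apply;
    rewrite setD11.
case/connectP=> p; elim/last_ind: p y => [|p y' IH] y /=; first by move=> _ ->.
rewrite rcons_path last_rcons => /andP[xp lk] ->{y};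
  apply: (connect_trans (IH _ xp erefl)).
case/existsP: lk => j /and3P[jS lj y'j]; apply/connect1/existsP; exists j.
rewrite in_setD1 jS lj y'j !andbT; apply: contraNneq z_far => ji;
  rewrite ji in jS lj.
apply: (@connect_trans _ _ (last x p)); first by apply/connectP; exists p.
by apply/connect1/existsP; exists i; rewrite jS lj.
Qed.

End Separation.

(** * Nests and level nestings *)

Section Nests.
Variables (n : nat) (t : PT n.+1).
Implicit Types (g h i j e : 'I_n) (u v x : 'I_n.+1) (N S : {set 'I_n})
  (NN : {set {set 'I_n}}).

Lemma incident_upper i : incident t (upper i) i.
Proof. by rewrite /incident eqxx. Qed.

(** Connectedness becomes convexity, tested on upper ends only, because the path between the two
    ends of an edge is that edge. *)
Lemma nestP N : reflect
  (N != set0 /\ {in N &, forall i j, sep t (upper i) (upper j) \subset N}) (nest t N).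
Proof.
have endpoint i u : i \in N -> incident t u i -> sep t u (upper i) \subset N.
  move=> iN ui; apply: subset_trans (incident_sep ui (incident_upper i)) _.
  by rewrite sub1set.
apply: (iffP andP) => -[N0 conn]; split=> //.
  move=> i j iN jN; rewrite -connect_linked.
  move/forall_inP: conn => /(_ (upper i))/(_ _)/forall_inP; apply.
    by rewrite inE; apply/exists_inP; exists i; rewrite ?incident_upper.
  by rewrite inE; apply/exists_inP; exists j; rewrite ?incident_upper.
apply/forall_inP=> u; rewrite inE => /exists_inP[i iN ui].
apply/forall_inP=> v; rewrite inE => /exists_inP[j jN vj].
rewrite connect_linked; apply: (sep_trans (endpoint _ _ iN ui)).
by apply: (sep_trans (conn _ _ iN jN)); rewrite sepC endpoint.
Qed.

Lemma nest_sep N i j u v : nest t N -> i \in N -> j \in N ->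
  incident t u i -> incident t v j -> sep t u v \subset N.
Proof.
move=> /nestP[_ conn] iN jN ui vj.
apply: (@sep_trans _ _ (upper i)).
  by apply: subset_trans (incident_sep ui (incident_upper i)) _; rewrite sub1set.
apply: (sep_trans (conn _ _ iN jN)).
by apply: subset_trans (incident_sep (incident_upper j) vj) _; rewrite sub1set.
Qed.

(** An edge separates one of its ends from any given vertex. Choosing this far end for [i], then for
    [j], gives a path through both. *)
Lemma sep_endpoints i j : i != j -> exists u v,
  [/\ incident t u i, incident t v j, i \in sep t u v & j \in sep t u v].
Proof.
have far_end k x : exists2 u, incident t u k & k \in sep t u x.
  have k_edge : k \in sep t (upper k) (lower t k) by rewrite sep_edge inE.
  have [kx|kx] := boolP (k \in sep t (upper k) x); first by exists (upper k);
    rewrite ?incident_upper.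
  exists (lower t k); first by rewrite /incident eqxx orbT.
  by move: k_edge kx; rewrite !in_sep negbK eq_sym => + /eqP<-.
move=> neq_ij; have [u ui iu] := far_end i (upper j); have [v vj jv] := far_end j u.
exists u, v; rewrite [sep t u v]sepC; split=> //.
have /subsetP/(_ i) := incident_sep vj (incident_upper j).
rewrite !in_sep inE (negPf neq_ij); move: iu; rewrite in_sep eq_sym => iu.
by have [-> //|_ /(_ isT)] := eqVneq (above t i v) (above t i (upper j)).
Qed.

Lemma nest_setT : 0 < n -> nest t [set: 'I_n].
Proof.
move=> n_gt0; apply/nestP; split; last by move=> i j _ _; exact: subsetT.
by apply/set0Pn; exists (Ordinal n_gt0); rewrite inE.
Qed.

Lemma nest_set1 i : nest t [set i].
Proof.
apply/nestP; split; first by apply/set0Pn; exists i; rewrite inE.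
by move=> j k /set1P-> /set1P->; rewrite sepxx sub0set.
Qed.

Lemma nest_setI N1 N2 : nest t N1 -> nest t N2 -> N1 :&: N2 != set0 ->
  nest t (N1 :&: N2).
Proof.
move=> /nestP[_ N1c] /nestP[_ N2c] N0; apply/nestP; split=> //.
by move=> i j /setIP[i1 i2] /setIP[j1 j2]; rewrite subsetI N1c ?N2c.
Qed.

Lemma nest_setU N1 N2 x i1 i2 : nest t N1 -> nest t N2 ->
  i1 \in N1 -> incident t x i1 -> i2 \in N2 -> incident t x i2 ->
    nest t (N1 :|: N2).
Proof.
move=> n1 n2 i1N xi1 i2N xi2; apply/nestP; split.
  by apply/set0Pn; exists i1; rewrite inE i1N.
have to_x i : i \in N1 :|: N2 -> sep t (upper i) x \subset N1 :|: N2.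
  case/setUP=> iN.
    by apply: subset_trans (subsetUl _ _); apply: (nest_sep n1 iN i1N);
      rewrite ?incident_upper.
  by apply: subset_trans (subsetUr _ _); apply: (nest_sep n2 iN i2N);
    rewrite ?incident_upper.
move=> i j /to_x i_x /to_x j_x; apply: sep_trans i_x _; by rewrite sepC.
Qed.

Lemma adjacent_sym i j : adjacent t i j = adjacent t j i.
Proof. by rewrite /adjacent eq_sym; congr (_ && _); apply: eq_existsb => v;
  rewrite andbC. Qed.

Lemma adjacent_sep i j : adjacent t i j ->
  sep t (upper i) (upper j) \subset [set i; j].
Proof.
case/andP=> _ /existsP[v /andP[vi vj]]; apply: (@sep_trans _ _ v).
  by apply: subset_trans (incident_sep (incident_upper i) vi) _;
    rewrite sub1set !inE eqxx.
by apply: subset_trans (incident_sep vj (incident_upper j)) _;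
  rewrite sub1set !inE eqxx orbT.
Qed.

(** The connected component of [g] in the forest [S], meaningful when [g] is in [S]. *)
Definition edge_comp S g : {set 'I_n} :=
  [set e in S | sep t (upper g) (upper e) \subset S].

Lemma edge_comp_sub S g : edge_comp S g \subset S.
Proof. by apply/subsetP=> e; rewrite inE => /andP[]. Qed.

Lemma edge_comp_self S g : g \in S -> g \in edge_comp S g.
Proof. by move=> gS; rewrite inE gS sepxx sub0set. Qed.

Lemma sep_edge_comp S g v : sep t (upper g) v \subset S ->
  sep t (upper g) v \subset edge_comp S g.
Proof.
move=> gvS; apply/subsetP=> e e_gv; rewrite inE (subsetP gvS) //=.
exact: subset_trans (sep_convex e_gv (incident_upper e)) gvS.
Qed.

Lemma nest_edge_comp S g : g \in S -> nest t (edge_comp S g).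
Proof.
move=> gS; apply/nestP; split; first by apply/set0Pn; exists g;
  exact: edge_comp_self.
move=> i j; rewrite !inE => /andP[iS gi] /andP[jS gj].
apply: (@sep_trans _ _ (upper g)); last exact: sep_edge_comp.
by rewrite sepC; exact: sep_edge_comp.
Qed.

Lemma nest_sub_edge_comp S N g : nest t N -> g \in N -> N \subset S ->
  N \subset edge_comp S g.
Proof.
move=> /nestP[_ conn] gN NS; apply/subsetP=> e eN; rewrite inE (subsetP NS) //=.
exact: subset_trans (conn _ _ gN eN) NS.
Qed.

Lemma edge_comp_adjacent S g i j :
  i \in edge_comp S g -> j \in S -> adjacent t i j -> j \in edge_comp S g.
Proof.
rewrite !inE => /andP[iS gi] jS /adjacent_sep ij; rewrite jS /=.
apply: sep_trans gi _; apply: subset_trans ij _.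
by apply/subsetP=> k /set2P[]->.
Qed.

Lemma nestingP NN : reflect
  [/\ forall N, N \in NN -> nest t N, 0 < n -> [set: 'I_n] \in NN,
      forall N1 N2, N1 \in NN -> N2 \in NN ->
        [\/ N1 \subset N2, N2 \subset N1 | [disjoint N1 & N2]]
    & forall N1 N2 i j, N1 \in NN -> N2 \in NN -> [disjoint N1 & N2] ->
        i \in N1 -> j \in N2 -> ~~ adjacent t i j]
  (nesting t NN).
Proof.
apply: (iffP and4P) => -[nests top laminar far]; split.
- by move/forall_inP: nests.
- by move/implyP: top.
- move=> N1 N2 N1N N2N; have [->|neq] := eqVneq N1 N2; first by constructor 1.
  move/forall_inP: laminar => /(_ _ N1N)/forall_inP/(_ _ N2N)/implyP/(_ neq).
  by case/or3P=> [/proper_sub|/proper_sub|];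
    [constructor 1|constructor 2|constructor 3].
- move=> N1 N2 i j N1N N2N dis iN1 jN2.
  move/forall_inP: far => /(_ _ N1N)/forall_inP/(_ _ N2N)/implyP/(_ dis).
  by move/forall_inP/(_ _ iN1)/forall_inP/(_ _ jN2).
- exact/forall_inP.
- exact/implyP.
- apply/forall_inP=> N1 N1N; apply/forall_inP=> N2 N2N; apply/implyP=> neq.
  rewrite !properEneq [N2 == N1]eq_sym neq /=.
  by case: (laminar _ _ N1N N2N) => ->; rewrite ?orbT.
- apply/forall_inP=> N1 N1N; apply/forall_inP=> N2 N2N; apply/implyP=> dis.
  by apply/forall_inP=> i iN; apply/forall_inP=> j jN; apply: (far N1 N2).
Qed.

Local Open Scope ring_scope.
Implicit Types c : 'I_n -> int.

Definition level_set c g : {set 'I_n} := [set e | c e <= c g].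
Definition level_nest c g := edge_comp (level_set c g) g.
Definition level_nesting c : {set {set 'I_n}} := [set level_nest c g | g : 'I_n].

Lemma level_setxx c g : g \in level_set c g. Proof. by rewrite inE. Qed.

Lemma level_nestxx c g : g \in level_nest c g.
Proof. exact/edge_comp_self/level_setxx. Qed.

Lemma nest_level_nest c g : nest t (level_nest c g).
Proof. exact/nest_edge_comp/level_setxx. Qed.

Lemma level_nest_in c g : level_nest c g \in level_nesting c.
Proof. exact: imset_f. Qed.

Lemma level_nest_le c g e : e \in level_nest c g -> c e <= c g.
Proof. by rewrite inE => /andP[]; rewrite inE. Qed.

Lemma level_nest_sub c g h e : c g <= c h ->
  e \in level_nest c g -> e \in level_nest c h ->
    level_nest c g \subset level_nest c h.
Proof.
move=> gh e_g e_h; have gh_sub : level_nest c g \subset level_set c h.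
  by apply/subsetP=> j /level_nest_le jg; rewrite inE (le_trans jg).
apply/subsetP=> j jg; rewrite inE (subsetP gh_sub) //=.
have /andP[_ he] : (e \in level_set c h) &&
  (sep t (upper h) (upper e) \subset level_set c h).
  by move: e_h; rewrite inE.
apply: sep_trans he _; apply: subset_trans gh_sub.
by have /nestP[_] := nest_level_nest c g; apply.
Qed.

(** When two components of sublevel sets meet or are adjacent, the one of lower level lies in the
    larger sublevel set, hence in the other component. *)
Lemma nesting_level_nesting c : nesting t (level_nesting c).
Proof.
apply/nestingP; split.
- by move=> _ /imsetP[g _ ->]; exact: nest_level_nest.
- move=> n_gt0; pose g := [arg max_(i > Ordinal n_gt0) c i]%O.
  apply/imsetP; exists g => //; apply/esym/eqP; rewrite -subTset.
  apply: nest_sub_edge_comp; rewrite ?nest_setT ?inE //.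
  apply/subsetP=> e _; rewrite inE /g;
    case: Order.TotalTheory.arg_maxP => // i _; exact.
- move=> _ _ /imsetP[g _ ->] /imsetP[h _ ->].
  have [dis|] := boolP [disjoint level_nest c g & level_nest c h];
    first by constructor 3.
  rewrite -setI_eq0 => /set0Pn[e /setIP[eg eh]].
  have [gh|/ltW hg] := leP (c g) (c h); [constructor 1|constructor 2];
    exact: level_nest_sub eg eh || exact: level_nest_sub eh eg.
- move=> _ _ i j /imsetP[g _ ->] /imsetP[h _ ->].
  wlog gh : g h i j / c g <= c h.
    move=> W; have [|/ltW hg] := leP (c g) (c h); first exact: W.
    rewrite disjoint_sym adjacent_sym => dis ig jh; exact: W hg dis jh ig.
  move=> dis ig jh; apply/negP=> adj.
  have := disjointFr dis ig; rewrite (edge_comp_adjacent jh) //.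
    by rewrite inE (le_trans (level_nest_le ig)).
  by rewrite adjacent_sym.
Qed.

Lemma min_level_nesting c g : min_nest (level_nesting c) g = level_nest c g.
Proof.
apply/eqP; rewrite eqEsubset; apply/andP; split.
  by apply: bigcap_inf; rewrite level_nest_in level_nestxx.
apply/bigcapsP=> _ /andP[/imsetP[h _ ->] gh].
exact: level_nest_sub (level_nest_le gh) (level_nestxx c g) gh.
Qed.

Lemma level_nest_inj c : injective c -> injective (level_nest c).
Proof.
move=> c_inj g h gh; apply: c_inj; apply/eqP; rewrite eq_le.
by rewrite (level_nest_le (_ : g \in level_nest c h)) -?gh ?level_nestxx //
  (level_nest_le (_ : h \in level_nest c g)) // gh level_nestxx.
Qed.

Lemma maximal_level_nesting c : injective c -> maximal_nesting t (level_nesting c).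
Proof.
move=> c_inj; rewrite /maximal_nesting nesting_level_nesting card_imset ?card_ord ?eqxx //.
exact: level_nest_inj.
Qed.

(** Let [h] be an edge of [level_nest c g] with highest [c']. Refinement forces [c h = c g], and the
    component of [g] for [c] is then that of [h] for [c']. *)
Lemma level_nesting_refine c c' : (forall i j, c i < c j -> c' i < c' j) ->
  level_nesting c \subset level_nesting c'.
Proof.
move=> refines; apply/subsetP=> _ /imsetP[g _ ->].
pose h := [arg max_(i > g in level_nest c g) c' i]%O.
have [hg h_max] : h \in level_nest c g /\ {in level_nest c g, forall i, c' i <= c' h}.
  by rewrite /h; case: Order.TotalTheory.arg_maxP; [exact: level_nestxx|].
have ch : c h = c g.
  apply/eqP; rewrite eq_le (level_nest_le hg) leNgt; apply/negP=> /refines.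
  by rewrite ltNge h_max ?level_nestxx.
apply/imsetP; exists h => //; apply/eqP; rewrite eqEsubset; apply/andP; split.
  apply: nest_sub_edge_comp => //; first exact: nest_level_nest.
  by apply/subsetP=> e eg; rewrite inE h_max.
have sub : level_nest c' h \subset level_set c g.
  apply/subsetP=> e /level_nest_le; rewrite inE -ch !leNgt; apply: contra;
    exact: refines.
have gh : level_nest c' h \subset level_nest c h.
  apply: nest_sub_edge_comp; rewrite ?nest_level_nest ?level_nestxx //.
  by apply: subset_trans sub _; apply/subsetP=> e; rewrite !inE ch.
apply: subset_trans gh _; apply: (@level_nest_sub _ _ _ h);
  rewrite ?ch ?level_nestxx //.
Qed.

(** The lexicographic order on the pairs of [c i] and [i], encoded by integers thanks to [i < n]. *)
Definition tie_break c i : int := c i * n%:Z + i%:Z.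

Lemma tie_break_lt c i j : c i < c j -> tie_break c i < tie_break c j.
Proof. by rewrite /tie_break; have := ltn_ord i; nia. Qed.

Lemma tie_break_inj c : injective (tie_break c).
Proof.
move=> i j eq_ij; have [/tie_break_lt|/tie_break_lt|cij] := ltgtP (c i) (c j).
- by rewrite eq_ij ltxx.
- by rewrite eq_ij ltxx.
- by apply/val_inj => /=; move: eq_ij; rewrite /tie_break cij => /addrI [].
Qed.

(** Among the nests containing [g], one of least cardinality lies in all the others by laminarity,
    so the intersection is attained. *)
Lemma min_nest_in NN g : nesting t NN -> min_nest NN g \in NN.
Proof.
case/nestingP=> _ top laminar _;
  have T_in := top (leq_ltn_trans (leq0n _) (ltn_ord g)).
case: (@arg_minnP _ [set: 'I_n] [pred N in NN | g \in N] (fun N => #|N|)) =>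
  [|N /= /andP[NN_N gN] N_min].
  by rewrite /= T_in inE.
suff -> : min_nest NN g = N by [].
apply/eqP; rewrite eqEsubset; apply/andP; split; first by apply: bigcap_inf;
  rewrite NN_N.
apply/bigcapsP=> N' /andP[NN_N' gN'];
  case: (laminar _ _ NN_N NN_N') => // [sub|dis].
  suff /eqP-> : N' == N by [].
  by rewrite eqEcard sub N_min //= NN_N'.
by rewrite (disjointFr dis gN) in gN'.
Qed.

Lemma mem_min_nest NN g : g \in min_nest NN g.
Proof. by apply/bigcapP=> N /andP[]. Qed.

Lemma min_nest_sub NN N g : N \in NN -> g \in N -> min_nest NN g \subset N.
Proof. by move=> NN_N gN; apply: bigcap_inf; rewrite NN_N. Qed.

Definition codepth NN i : int := - #|[set N in NN | i \in N]|%:Z.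

Lemma codepth_le NN g e : nesting t NN -> e \in min_nest NN g ->
  codepth NN e <= codepth NN g.
Proof.
move=> NN_nesting eg; rewrite lerN2 lez_nat subset_leq_card //.
apply/subsetP=> N; rewrite !inE => /andP[NN_N gN]; rewrite NN_N.
exact: (subsetP (min_nest_sub NN_N gN)).
Qed.

(** An edge [k] that touches [M] from outside has higher level than [g]: a nest containing [k] is
    neither inside [M] nor disjoint from it, since disjoint nests are not adjacent, so it contains
    [M] and [g], while [M] itself counts for [g] only. Hence a walk in the sublevel set never leaves
    [M]. *)
Lemma level_nest_codepth NN g : nesting t NN ->
  level_nest (codepth NN) g = min_nest NN g.
Proof.
move=> NN_nesting; have M_in := min_nest_in g NN_nesting;
  set M := min_nest NN g in M_in *.
have /nestingP[nests _ laminar far] := NN_nesting.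
apply/eqP; rewrite eqEsubset andbC; apply/andP; split.
  apply: nest_sub_edge_comp; [exact: nests|exact: mem_min_nest|].
  by apply/subsetP=> e eM; rewrite inE codepth_le.
have closed j k v : j \in M -> incident t v j -> incident t v k ->
    codepth NN k <= codepth NN g -> k \in M.
  move=> jM vj vk; apply: contraTT => kM; rewrite -ltNge ltrN2 ltz_nat.
  apply: proper_card; apply/properP; split; last first.
    by exists M; rewrite !inE M_in ?mem_min_nest // (negPf kM).
  apply/subsetP=> N; rewrite !inE => /andP[NN_N kN]; rewrite NN_N /=.
  case: (laminar _ _ M_in NN_N) => [sub|sub|dis].
  - by rewrite (subsetP sub) ?mem_min_nest.
  - by rewrite (subsetP sub) in kM.
  have := far _ _ _ _ M_in NN_N dis jM kN; rewrite /adjacent.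
  have -> /= : j != k by apply: contraNneq kM => <-.
  by case/existsP; exists v; rewrite vj.
have inM v : sep t (upper g) v \subset level_set (codepth NN) g ->
    exists2 j, j \in M & incident t v j.
  rewrite -connect_linked => /connectP[p]; elim/last_ind: p v => [|p v' IH] v /=.
    by move=> _ ->; exists g; rewrite ?mem_min_nest ?incident_upper.
  rewrite rcons_path last_rcons => /andP[gp /existsP[k /and3P[kS lk vk]]] ->.
  have [j jM lj] := IH _ gp erefl; exists k => //.
  by apply: closed jM lj lk _; rewrite inE in kS.
apply/subsetP=> e; rewrite inE => /andP[eS /inM[j jM ej]].
by apply: closed jM ej (incident_upper e) _; rewrite inE in eS.
Qed.

(** Each nest is the smallest one around its edge of highest level. *)
Lemma level_nesting_codepth NN : nesting t NN -> level_nesting (codepth NN) = NN.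
Proof.
move=> NN_nesting; apply/setP=> N; apply/imsetP/idP=> [[g _ ->]|NN_N].
  by rewrite level_nest_codepth // min_nest_in.
have /nestingP[/(_ _ NN_N) N_nest _ _ _] := NN_nesting.
have /nestP[/set0Pn[g0 g0N] _] := N_nest.
case: (Order.TotalTheory.arg_maxP (codepth NN) g0N) => g gN g_max.
exists g => //; apply/eqP; rewrite eqEsubset; apply/andP; split.
  by apply: nest_sub_edge_comp => //; apply/subsetP=> e eN; rewrite inE;
    apply: g_max.
by rewrite level_nest_codepth // min_nest_sub.
Qed.

(** Breaking ties in [codepth NN] gives a nesting that contains [NN] and has the same cardinality
    [n]. *)
Lemma maximal_nestingP NN : maximal_nesting t NN ->
  exists2 c, injective c & NN = level_nesting c.
Proof.
case/andP=> NN_nesting /eqP NN_card; exists (tie_break (codepth NN));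
  first exact: tie_break_inj.
apply/eqP; rewrite eqEcard -{1}(level_nesting_codepth NN_nesting).
rewrite (level_nesting_refine (@tie_break_lt _)) NN_card.
by have /andP[_ /eqP->] /= := maximal_level_nesting (@tie_break_inj (codepth NN)).
Qed.

Lemma maximal_nesting_ex NN : nesting t NN ->
  exists2 NN', maximal_nesting t NN' & NN \subset NN'.
Proof.
move=> NN_nesting; exists (level_nesting (tie_break (codepth NN))).
  exact/maximal_level_nesting/tie_break_inj.
by rewrite -{1}(level_nesting_codepth NN_nesting) level_nesting_refine // => i j;
  exact: tie_break_lt.
Qed.

(* Raising the edges of N by less than one level postpones N until edges of   *)
(* the smallest nest of NN around N have been added to it.                    *)
Lemma maximal_nesting_avoid NN N : nesting t NN -> nest t N -> N \notin NN ->
  exists NN', [/\ maximal_nesting t NN', NN \subset NN' & N \notin NN'].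
Proof.
move=> NN_nesting N_nest N_notin; set c0 := codepth NN.
pose c1 i : int := 2 * c0 i + (i \in N)%:Z; pose c2 := tie_break c1.
have c01 i j : c0 i < c0 j -> c1 i < c1 j by rewrite /c1;
  case: (i \in N) (j \in N) => [] []; lia.
exists (level_nesting c2); split; first exact/maximal_level_nesting/tie_break_inj.
  rewrite -{1}(level_nesting_codepth NN_nesting) level_nesting_refine // =>
    i j /c01.
  exact: tie_break_lt.
apply/negP=> /imsetP[h _ def_N]; have hN : h \in N by rewrite def_N level_nestxx.
suff def_M : N = level_nest c0 h.
  by rewrite def_M level_nest_codepth // min_nest_in in N_notin.
apply/eqP; rewrite eqEsubset; apply/andP; split.
  apply: nest_sub_edge_comp => //; apply/subsetP=> e eN; rewrite inE leNgt;
    apply/negP=> lt_he.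
  have : c2 e <= c2 h by apply: level_nest_le; rewrite -def_N.
  by rewrite leNgt tie_break_lt // c01.
suff : level_nest c0 h \subset level_nest c2 h by rewrite -def_N.
apply: nest_sub_edge_comp; rewrite ?nest_level_nest ?level_nestxx //.
apply/subsetP=> e /level_nest_le le_eh; rewrite inE.
have [eN|eN] := boolP (e \in N); first by apply: level_nest_le; rewrite -def_N.
by apply/ltW/tie_break_lt; rewrite /c1 hN (negPf eN) /=;
  move: (c0 e) (c0 h) le_eh; lia.
Qed.

End Nests.

(** * Contraction of edges *)

Lemma mem_input_addrs k inputs a : a \in input_addrs k inputs ->
  exists j b, [/\ j < size inputs, a = (k + j) :: b & b \in nth [::] inputs j].
Proof.
elim: inputs k => //= L inputs IH k;
  rewrite /input_addrs /= mem_cat => /orP[/mapP[b bL ->]|].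
  by exists 0, b; rewrite addn0.
by move=> /IH[j [b [lt_j -> b_in]]]; exists j.+1, b; rewrite addSnnS.
Qed.

Section Grow.
Variables (T : eqType) (ch : T -> seq T).
Implicit Types (v : T) (a : seq nat).

(** The tree unfolded from the lists of children [ch], with fuel [k]; the first input [Leaf] gives
    every vertex at least one input. *)
Fixpoint grow k v : ptree :=
  if k is k'.+1 then Node Leaf (map (grow k') (ch v)) else Leaf.

Fixpoint preorder k v : seq T :=
  if k is k'.+1 then v :: flatten (map (preorder k') (ch v)) else [::].

(* Input 0 of every vertex of [grow k v] is a leaf. *)
Definition walk v a : T := foldl (fun u j => nth u (ch u) j.-1) v a.

Lemma vaddr_grow k v : vaddr (grow k.+1 v) =
  [::] :: input_addrs 1 (map vaddr (map (grow k) (ch v))).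
Proof. by []. Qed.

Lemma nvert_grow k v : nvert (grow k v) = size (preorder k v).
Proof.
elim: k v => //= k IH v; rewrite add0n size_flatten /shape -!map_comp.
by congr (sumn _).+1; apply: eq_map => u /=.
Qed.

Lemma map_walk k v : map (walk v) (vaddr (grow k v)) = preorder k v.
Proof.
elim: k v => // k IH v; rewrite vaddr_grow /=; congr (_ :: _).
have gen l1 l2 : ch v = l1 ++ l2 ->
    map (walk v) (input_addrs (size l1).+1 (map vaddr (map (grow k) l2))) =
    flatten (map (preorder k) l2).
  elim: l2 l1 => //= u l2 IHl l1 def_l; rewrite /input_addrs /= map_cat;
    congr (_ ++ _).
    by rewrite -IH -map_comp; apply: eq_map => a /=;
      rewrite def_l nth_cat ltnn subnn.
  by have := IHl (rcons l1 u); rewrite cat_rcons size_rcons; apply.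
exact: (gen [::]).
Qed.

Lemma walk_child k v a : a \in vaddr (grow k v) -> a != [::] ->
  walk v a \in ch (walk v (take (size a).-1 a)).
Proof.
elim: k v a => // k IH v a; rewrite vaddr_grow inE => /orP[->//|].
case/mem_input_addrs=> j [b [lt_j -> b_in]] _; rewrite !size_map in lt_j.
have nthE : nth [::] (map vaddr (map (grow k) (ch v))) j =
  vaddr (grow k (nth v (ch v) j)).
  by rewrite -map_comp (nth_map v).
rewrite nthE in b_in; have [->|b_neq] := eqVneq b [::]; first by rewrite /= mem_nth.
have := IH _ _ b_in b_neq; case: b {b_in} b_neq => // j' b _ /=.
Qed.

End Grow.

Section Preorder.
Variables (n : nat) (V : {set 'I_n.+1}) (p : 'I_n.+1 -> 'I_n.+1).
Hypothesis V0 : ord0 \in V.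
Hypothesis p_lt : forall v, v \in V -> v != ord0 -> (p v \in V) && (p v < v).

Definition children v := enum [set u in V | (u != ord0) && (p u == v)].

Lemma mem_children u v : (u \in children v) = [&& u \in V, u != ord0 & p u == v].
Proof. by rewrite mem_enum inE. Qed.

Local Notation pre := (preorder children).

Lemma count_preorder x k v : count_mem x (pre k.+1 v) =
  (v == x) + sumn [seq count_mem x (pre k u) | u <- children v].
Proof. by rewrite /= count_flatten -map_comp. Qed.

Lemma count_preorder0 k v : count_mem ord0 (pre k.+1 v) = (v == ord0).
Proof.
elim: k v => [|k IH] v; rewrite count_preorder.
  by rewrite (eq_map (_ : _ =1 fun=> 0)) // sumnE big_map big1_eq addn0.
rewrite sumnE big_map big_seq big1 ?addn0 // => u;
  rewrite mem_children => /and3P[_ /negPf u0 _].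
by rewrite IH u0.
Qed.

(** Apart from [v] itself, an occurrence of [x] is a child of an occurrence of [p x], reached with
    one unit of fuel less, and [x] is listed once among the children of [p x]. *)
Lemma count_preorderS x k v : x \in V -> x != ord0 ->
  count_mem x (pre k.+1 v) = (v == x) + count_mem (p x) (pre k v).
Proof.
move=> xV x0; elim: k v => [|k IH] v; rewrite count_preorder.
  by rewrite (eq_map (_ : _ =1 fun=> 0)) // sumnE big_map big1_eq addn0.
rewrite count_preorder; congr (_ + _);
  rewrite (eq_map IH) !sumnE !big_map big_split /=.
congr (_ + _).
have -> : \sum_(u <- children v) (u == x : nat) = count_mem x (children v).
  by rewrite -sum1_count [RHS]big_mkcond.
by rewrite count_uniq_mem ?enum_uniq // mem_children xV x0 /= eq_sym.
Qed.

(** As [p] decreases numbers, [x] has depth at most [x], so this fuel reaches it; replacing [x] by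
    [p x] keeps the count until the root. *)
Lemma count_preorder_root x k : x \in V -> x < k -> count_mem x (pre k ord0) = 1.
Proof.
have [m] := ubnP (x : nat); elim: m x k => // m IH x [//|k];
  rewrite !ltnS => le_xm xV le_xk.
have [->|x0] := eqVneq x ord0; first by rewrite count_preorder0 eqxx.
have /andP[pV lt_p] := p_lt xV x0.
rewrite count_preorderS // eq_sym (negPf x0) IH //.
  exact: leq_trans lt_p le_xm.
exact: leq_trans lt_p le_xk.
Qed.

Lemma preorder_sub k v : v \in V -> {subset pre k v <= V}.
Proof.
elim: k v => //= k IH v vV x; rewrite inE => /orP[/eqP->//|/flatten_mapP[u]].
by rewrite mem_children => /and3P[uV _ _]; exact: IH.
Qed.

Lemma mem_preorder : pre n.+1 ord0 =i V.
Proof.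
move=> x; apply/idP/idP => [|xV]; first exact: preorder_sub.
by rewrite -has_pred1 has_count count_preorder_root.
Qed.

Lemma preorder_uniq : uniq (pre n.+1 ord0).
Proof.
apply: count_mem_uniq => x; rewrite mem_preorder.
have [xV|xV] := boolP (x \in V); first by rewrite count_preorder_root.
by apply/count_memPn; rewrite mem_preorder.
Qed.

Lemma size_preorder : size (pre n.+1 ord0) = #|V|.
Proof. by rewrite -(card_uniqP preorder_uniq); apply: eq_card;
  exact: mem_preorder. Qed.

End Preorder.

Section Contraction.
Variables (n : nat) (t : PT n.+1) (A : {set 'I_n}).
Implicit Types (g : 'I_n) (u v : 'I_n.+1).

(** The lowest vertex of each class of the contraction. *)
Let kept : {set 'I_n.+1} := ord0 |: [set upper g | g in A].

Let card_kept : #|kept| = #|A|.+1.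
Proof.
rewrite cardsU1 card_imset; last exact: upper_inj.
have -> // : ord0 \notin [set upper g | g in A].
by apply/imsetP=> -[g _ /eqP]; rewrite (negPf (neq_lift _ _)).
Qed.

(** Go down from [u] along edges outside [A] until reaching the root or the upper end of an edge of
    [A]. *)
Lemma contraction_rep u : exists r : 'I_n.+1,
  [&& r \in kept, r <= u & [disjoint sep t u r & A]].
Proof.
have [k] := ubnP (u : nat); elim: k u => // k IH u; rewrite ltnS => le_uk.
have [->|[g def_u]] := vertexP u.
  by exists ord0; rewrite sepxx !inE eqxx /= -setI_eq0 set0I.
have [gA|gA] := boolP (g \in A).
  exists u; rewrite leqnn sepxx -setI_eq0 set0I eqxx !inE andbT def_u.
  by rewrite imset_f ?orbT.
have lt_lu : lower t g < u by rewrite def_u val_upper ltnS lower_le.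
have [r /and3P[rK le_r dis]] := IH _ (leq_trans lt_lu le_uk).
exists r; rewrite rK (leq_trans le_r (ltnW lt_lu)) /=.
have sub : sep t u r \subset g |: sep t (lower t g) r.
  apply: (@sep_trans _ _ (lower t g)); rewrite ?subsetUr //.
  by rewrite def_u sep_edge sub1set setU11.
apply: disjointWl sub _; rewrite -setI_eq0 setIUl setU_eq0 setI_eq0 disjoints1 gA.
by rewrite setI_eq0.
Qed.

(* q is the quotient map that contracts the edges outside A. *)
Lemma tree_contraction :
  exists (s : PT #|A|.+1) (sigma : 'I_#|A| -> 'I_n) (q : 'I_n.+1 -> 'I_#|A|.+1),
    [/\ injective sigma, forall i, sigma i \in A
      & forall u v i, (i \in sep s (q u) (q v)) = (sigma i \in sep t u v)].
Proof.
have [rep repP] := fin_all_exists contraction_rep.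
have rep_kept u : rep u \in kept by have /and3P[] := repP u.
have above_rep g u : g \in A -> above t g (rep u) = above t g u.
  move=> gA; have /and3P[_ _ dis] := repP u; apply/esym/eqP.
  by have := disjointFl dis gA; rewrite in_sep => /negbFE.
have kept0 : ord0 \in kept by rewrite setU11.
(* The parent in the contracted tree is the representative of the parent in [t]. *)
pose p v := rep (pred_vertex t v).
have p_upper g : p (upper g) = rep (lower t g) by rewrite /p /pred_vertex liftK.
have p_lt v : v \in kept -> v != ord0 -> (p v \in kept) && (p v < v).
  have [->|[g ->]] := vertexP v; first by rewrite eqxx.
  move=> _ _; rewrite p_upper rep_kept val_upper ltnS.
  by apply: leq_trans (lower_le t g); have /and3P[] := repP (lower t g).
set ch := children kept p; set s := grow ch n.+1 ord0.
have s_size : nvert s == #|A|.+1 by rewrite nvert_grow size_preorder // card_kept.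
pose s' : PT #|A|.+1 := exist _ s s_size.
have walkE : map (walk ch ord0) (vaddr s) =
  preorder ch n.+1 ord0 by exact: map_walk.
have size_s : size (vaddr s) = #|A|.+1.
  by rewrite -(size_map (walk ch ord0)) walkE size_preorder ?card_kept.
(* [phi] matches the vertices of the new tree, numbered in prefix order, with the kept vertices of
   [t]. *)
pose phi (b : 'I_#|A|.+1) := walk ch ord0 (nth [::] (vaddr s) b).
have phiE b : phi b = nth ord0 (preorder ch n.+1 ord0) b.
  by rewrite -walkE (nth_map [::]) ?size_s.
have phi_inj : injective phi.
  move=> b b'; rewrite !phiE => /eqP;
    rewrite nth_uniq ?preorder_uniq ?size_preorder ?card_kept //.
  by move=> /eqP/val_inj.
have phi_kept b : phi b \in kept.
  by rewrite phiE -(mem_preorder kept0 p_lt) mem_nth // size_preorder ?card_kept.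
have phi0 : phi ord0 = ord0 by rewrite phiE.
have phi_lower i : phi (lower s' i) = p (phi (upper i)).
  set a := nth [::] (vaddr s) (upper i).
  have a_in : a \in vaddr s by rewrite mem_nth // size_s.
  have a_neq : a != [::].
    apply/eqP=> a0; have := neq_lift (@ord0 #|A|) i; rewrite -(inj_eq phi_inj) phi0.
    by rewrite /phi -/(upper i) -/a a0 eqxx.
  have b_in : take (size a).-1 a \in vaddr s.
    have := prefix_closed_nth (prefix_closed_vaddr s) a_neq; exact: mem_take.
  have := walk_child a_in a_neq; rewrite mem_children => /and3P[_ _ /eqP->].
  rewrite /phi /lower inordK ?nth_index //.
  by have := b_in; rewrite -index_mem size_s.
have phi_surj v : v \in kept -> exists b, phi b = v.
  rewrite -(mem_preorder kept0 p_lt) => v_in.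
  have lt_v : index v (preorder ch n.+1 ord0) < #|A|.+1.
    by rewrite -card_kept -(size_preorder kept0 p_lt) index_mem.
  by exists (Ordinal lt_v); rewrite phiE nth_index.
have [q qE] := fin_all_exists (fun u => phi_surj _ (rep_kept u)).
have sigma_ex i : exists g, (g \in A) && (phi (upper i) == upper g).
  have := phi_kept (upper i); rewrite !inE.
  rewrite -phi0 (inj_eq phi_inj) eq_sym (negPf (neq_lift _ _)) /=.
  by case/imsetP=> g gA ->; exists g; rewrite gA eqxx.
have [sigma sigmaP] := fin_all_exists sigma_ex.
have sigma_in i : sigma i \in A by case/andP: (sigmaP i).
have phi_upper i : phi (upper i) = upper (sigma i) by case/andP: (sigmaP i) =>
  _ /eqP.
have sigma_inj : injective sigma.
  by move=> i j eq_ij; apply/upper_inj/phi_inj; rewrite !phi_upper eq_ij.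
have aboveE i b : above s' i b = above t (sigma i) (phi b).
  have [k] := ubnP (b : nat); elim: k b => // k IH b; rewrite ltnS => le_bk.
  have [->|[j def_b]] := vertexP b; first by rewrite phi0 !above0.
  rewrite def_b phi_upper !above_upper (inj_eq sigma_inj) IH.
    by rewrite phi_lower phi_upper p_upper above_rep.
  by apply: leq_trans le_bk; rewrite def_b val_upper ltnS lower_le.
exists s', sigma, q; split=> // u v i.
by rewrite !in_sep !aboveE !qE !above_rep.
Qed.

End Contraction.

Local Open Scope ring_scope.

(** * Weights of paths *)

Lemma sumr_gt0_ex (R : numDomainType) (I : finType) (P : pred I) (f : I -> R) i :
  (forall j, P j -> 0 <= f j) -> P i -> 0 < f i -> 0 < \sum_(j | P j) f j.
Proof.
move=> f_ge0 Pi fi; rewrite (bigD1 i) //= ltr_pwDl // sumr_ge0 // => j /andP[Pj _].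
exact: f_ge0.
Qed.

Lemma sum_pred_sub (R : zmodType) (I : finType) (P Q : pred I) (f : I -> R) :
  (forall i, P i -> Q i) ->
  \sum_(i | Q i) f i = \sum_(i | P i) f i + \sum_(i | Q i && ~~ P i) f i.
Proof.
move=> PQ; rewrite (bigID P) /=; congr (_ + _); apply: eq_bigl => i.
by apply: andb_idl => /PQ.
Qed.

Section Weights.
Variables (n : nat) (t : PT n.+1) (w : 'I_n.+1 -> int).
Implicit Types (g h i j e : 'I_n) (u v x : 'I_n.+1) (N S : {set 'I_n})
  (NN : {set {set 'I_n}}) (p : 'I_n.+1 * 'I_n.+1).

Local Notation path p := (sep t p.1 p.2).

(* Each unordered pair is counted twice. *)
Definition path_weight S : int :=
  \sum_(p : 'I_n.+1 * 'I_n.+1 | (p.1 != p.2) && (path p \subset S)) w p.1 * w p.2.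

Lemma sum_half (H Q : pred ('I_n.+1 * 'I_n.+1)) :
  (forall p, Q p = H p || H (swap_pair p)) -> (forall p, H p ->
    ~~ H (swap_pair p)) ->
  \sum_(p | Q p) w p.1 * w p.2 = 2 * \sum_(p | H p) w p.1 * w p.2.
Proof.
move=> QE H_asym; rewrite (bigID H) /= mulr_natl mulr2n; congr (_ + _).
  by apply: eq_bigl => p; rewrite QE; case: (H p); rewrite ?andbF.
rewrite [RHS](reindex_inj (inv_inj swap_pairK)) /=; apply: eq_big => [p|p _];
  last by rewrite mulrC.
rewrite QE; have := H_asym p; case: (H p) => /=; last by rewrite andbT.
by move/(_ isT)/negPf->.
Qed.

Lemma pairs_weightE (V : {set 'I_n.+1}) : 2 * pairs_weight w V =
  \sum_(p : 'I_n.+1 * 'I_n.+1 | [&& p.1 \in V, p.2 \in V & p.1 != p.2]) w p.1 * w p.2.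
Proof.
rewrite /pairs_weight pair_big_dep /=; apply/esym/sum_half => -[k l] /=.
  by rewrite -val_eqE /=; case: (k \in V) (l \in V) => [] [] //=; case: ltngtP.
by case: (k \in V) (l \in V) => [] [] //=; rewrite -leqNgt; exact: ltnW.
Qed.

Lemma sep_incident u v S : u != v -> sep t u v \subset S -> u \in nest_verts t S.
Proof.
rewrite -connect_linked => neq_uv /connectP[[|x q] /=]; first by move=> _ def_u;
  rewrite def_u eqxx in neq_uv.
case/andP=> /existsP[i /and3P[iS ui _]] _ _; rewrite inE.
by apply/exists_inP; exists i.
Qed.

(** Two distinct vertices both belong to [t(N)] exactly when their path stays in [N]. *)
Lemma path_weight_nest N : nest t N ->
  2 * pairs_weight w (nest_verts t N) = path_weight N.
Proof.
move=> N_nest; rewrite pairs_weightE; apply: eq_bigl => -[u v] /=;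
  rewrite andbA andbC.
have [//|neq_uv] /= := eqVneq u v; apply/andP/idP => [[]|uvN].
  by rewrite !inE => /exists_inP[i iN ui] /exists_inP[j jN vj];
    exact: nest_sep ui vj.
by split; [exact: sep_incident uvN|apply: (@sep_incident v u);
  rewrite 1?sepC // eq_sym].
Qed.

Lemma path_weight_setT : 2 * pairs_weight w [set: 'I_n.+1] = path_weight setT.
Proof. by rewrite pairs_weightE; apply: eq_bigl => p;
  rewrite !inE subsetT andbT. Qed.

Lemma path_weight_set0 : path_weight set0 = 0.
Proof.
apply: big1 => p /andP[neq]; rewrite subset0 sep_eq0 => eq; by rewrite eq in neq.
Qed.

Lemma level_nest_sep (c : 'I_n -> int) i u v : i \in sep t u v ->
  (sep t u v \subset level_nest t c i) = (sep t u v \subset level_set c i).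
Proof.
move=> i_uv; apply/idP/idP => [uvL|uvL];
  first exact: subset_trans uvL (edge_comp_sub _ _ _).
apply/subsetP=> e e_uv; rewrite inE (subsetP uvL) //=; apply: subset_trans uvL.
by apply: (@sep_trans _ _ u); [rewrite sepC|];
  apply: sep_convex (incident_upper _ _).
Qed.

Lemma cut_aboveE (c : 'I_n -> int) i u : (u \in cut_above t (level_nest t c i) i) =
  above t i u && (sep t (upper i) u \subset level_set c i).
Proof.
rewrite inE connect_linked subsetD1 in_sep above_upper eqxx /= andbC.
case: (above t i u) => //=; apply/idP/idP => [iu|]; last exact: sep_edge_comp.
exact: subset_trans iu (edge_comp_sub _ _ _).
Qed.

Lemma cut_belowE (c : 'I_n -> int) i u : (u \in cut_below t (level_nest t c i) i) =
  ~~ above t i u && (sep t (upper i) u \subset level_set c i).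
Proof.
have i_low : above t i (lower t i) = false.
  by apply/negP => /above_gt; rewrite ltnNge lower_le.
rewrite inE connect_linked subsetD1 in_sep i_low eq_sym eqbF_neg negbK andbC.
have [//|i_u /=] := boolP (above t i u).
have edge S : i \in S -> sep t (upper i) (lower t i) \subset S by rewrite sep_edge sub1set.
apply/idP/idP => iu.
  apply: sep_trans (edge _ (level_setxx c i)) _.
  exact: subset_trans iu (edge_comp_sub _ _ _).
apply: (@sep_trans _ _ (upper i)); last exact: sep_edge_comp.
by rewrite sepC edge // level_nestxx.
Qed.

Lemma sep_through i u v S : above t i u -> ~~ above t i v ->
  (sep t u v \subset S) = (sep t (upper i) u \subset S) &&
    (sep t (upper i) v \subset S).
Proof.
move=> iu iv; have i_uv : i \in sep t u v by rewrite in_sep iu (negPf iv).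
apply/idP/andP => [uvS|[iuS ivS]]; last by apply: sep_trans ivS; rewrite sepC.
split; apply: subset_trans uvS; first by rewrite sepC;
  apply: sep_convex (incident_upper _ _).
by rewrite sepC [sep t u v]sepC; apply: sep_convex (incident_upper _ _);
  rewrite sepC.
Qed.

(* A pair of vertices contributes to the coordinate of the edge of its path   *)
(* that is cut first, i.e. the one of highest level.                          *)
Lemma nesting_vector_level (c : 'I_n -> int) i :
  2 * nesting_vector t w (level_nesting t c) 0 i =
  \sum_(p : 'I_n.+1 * 'I_n.+1 | (i \in path p) &&
    (path p \subset level_set c i)) w p.1 * w p.2.
Proof.
rewrite mxE min_level_nesting big_distrlr pair_big /=;
  apply/esym/sum_half => -[u v] /=;
  rewrite !cut_aboveE !cut_belowE.
  have [iu|iu] := boolP (above t i u); have [iv|iv] := boolP (above t i v);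
    rewrite in_sep ?iu ?iv ?(negPf iu) ?(negPf iv) //= ?orbF ?andbF //.
    exact: sep_through.
  by rewrite sepC (sep_through _ iv iu).
by case: (above t i u); case: (above t i v); rewrite ?andbF.
Qed.

Section Vector.
Variables (c : 'I_n -> int) (c_inj : injective c).
Local Notation M := (nesting_vector t w (level_nesting t c)).

(** As [c] is injective, a path has a single edge of highest level, so no pair is counted twice when
    the sums are exchanged. *)
Lemma level_vector_sum S : 2 * (\sum_(i in S) M 0 i) =
  \sum_(p : 'I_n.+1 * 'I_n.+1 |
     [exists i in S, (i \in path p) &&
       (path p \subset level_set c i)]) w p.1 * w p.2.
Proof.
rewrite big_distrr /=; under eq_bigr do rewrite nesting_vector_level.
rewrite (exchange_big_dep xpredT) //= [RHS]big_mkcond /=; apply: eq_bigr => p _.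
case: ifPn => [/exists_inP[i iS /andP[ip pi]]|/exists_inPn none]; last first.
  by rewrite big1 // => i /andP[/none/negPf->].
rewrite (bigD1 i) /= ?iS ?ip //= big1 ?addr0 // => j /andP[/and3P[_ jp pj]].
case/eqP; apply: c_inj; apply/eqP; rewrite eq_le.
by move/subsetP: pi => /(_ _ jp); move/subsetP: pj => /(_ _ ip);
  rewrite !inE => -> ->.
Qed.

Lemma path_top p : p.1 != p.2 ->
  exists2 i, i \in path p & path p \subset level_set c i.
Proof.
rewrite -(sep_eq0 t) => /set0Pn[i0 i0p];
  case: (Order.TotalTheory.arg_maxP c i0p) => i ip i_max.
by exists i => //; apply/subsetP=> e ep; rewrite inE; exact: i_max.
Qed.

Let in_S S p : (p.1 != p.2) && (path p \subset S) ->
  [exists i in S, (i \in path p) && (path p \subset level_set c i)].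
Proof.
case/andP=> /path_top[i ip pi] /subsetP/(_ _ ip) iS.
by apply/exists_inP; exists i; rewrite ?ip.
Qed.

(** A path with highest edge [i] in [S] stays in the level nest of [i], hence in [S], so there is no
    excess. *)
Lemma level_vector_eq S : (forall i, i \in S -> level_nest t c i \subset S) ->
  2 * (\sum_(i in S) M 0 i) = path_weight S.
Proof.
move=> S_sat; rewrite level_vector_sum; apply: eq_bigl => p; apply/idP/idP;
  last exact: in_S.
case/exists_inP=> i /S_sat iS /andP[ip]; rewrite -level_nest_sep // => pi.
by rewrite (subset_trans pi iS) andbT -(sep_eq0 t); apply/set0Pn; exists i.
Qed.

Lemma level_vector_eq_nest N : N \in level_nesting t c ->
  2 * (\sum_(i in N) M 0 i) = path_weight N.
Proof.
case/imsetP=> g _ ->; apply: level_vector_eq => i ig.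
exact: level_nest_sub (level_nest_le ig) (level_nestxx _ c i) ig.
Qed.

Lemma level_vector_total : 2 * (\sum_i M 0 i) = path_weight setT.
Proof.
rewrite -(level_vector_eq (S := setT)) => [|i _]; last exact: subsetT.
by congr (2 * _); apply: eq_bigl => i; rewrite inE.
Qed.

Hypothesis w_gt0 : forall v, 0 < w v.

Lemma level_vector_ge S : path_weight S <= 2 * (\sum_(i in S) M 0 i).
Proof.
rewrite level_vector_sum (sum_pred_sub _ (@in_S S)) lerDl sumr_ge0 // => p _.
by rewrite mulr_ge0 // ltW.
Qed.

(** Let [g] be the highest edge of [N]. The level nest of [g] contains [N] strictly, so it has an
    edge [e] outside [N]. A path through [e] and [g] inside it has its highest edge [g] in [N] but
    leaves [N]: its weight is a strict excess. *)
Lemma level_vector_gt N : nest t N -> N \notin level_nesting t c ->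
  path_weight N < 2 * (\sum_(i in N) M 0 i).
Proof.
move=> N_nest; have /nestP[/set0Pn[g0 g0N] _] := N_nest.
case: (Order.TotalTheory.arg_maxP c g0N) => g gN g_max N_notin.
have NL : N \subset level_nest t c g.
  by apply: nest_sub_edge_comp => //; apply/subsetP=> e eN; rewrite inE;
    exact: g_max.
have [e eL eN] : exists2 e, e \in level_nest t c g & e \notin N.
  apply/subsetPn; apply: contraNN N_notin => LN; apply/imsetP; exists g => //.
  by apply/eqP; rewrite eqEsubset NL.
have [a [b [ae bg e_ab b_sep]]] : exists a b,
    [/\ incident t a e, incident t b g, e \in sep t a b & g \in sep t a b].
  by apply: sep_endpoints; apply: contraNneq eN => ->.
have abL : sep t a b \subset level_nest t c g.
  by apply: nest_sep ae bg => //; [exact: nest_level_nest|exact: level_nestxx].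
rewrite level_vector_sum (sum_pred_sub _ (@in_S N)) ltrDl.
apply: (@sumr_gt0_ex _ _ _ _ (a, b)) => [p _||]; rewrite ?mulr_gt0 //;
  first by rewrite mulr_ge0 // ltW.
apply/andP; split; last by rewrite negb_and orbC; apply/orP; left;
  apply/subsetPn; exists e.
apply/exists_inP; exists g; rewrite //= b_sep.
by apply: subset_trans abL (edge_comp_sub _ _ _).
Qed.

End Vector.

Lemma path_weight_modular S1 S2 :
  path_weight (S1 :|: S2) + path_weight (S1 :&: S2) =
  path_weight S1 + path_weight S2 +
  \sum_(p : 'I_n.+1 * 'I_n.+1 | [&& p.1 != p.2, path p \subset S1 :|: S2,
      ~~ (path p \subset S1) & ~~ (path p \subset S2)]) w p.1 * w p.2.
Proof.
rewrite /path_weight !(big_mkcond (fun p => _ && _)) /= -!big_split /=.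
apply: eq_bigr => p _; case: (p.1 != p.2) => /=; last by rewrite !addr0.
rewrite subsetI; have [p1|_] := boolP (path p \subset S1).
  by rewrite (subset_trans p1 (subsetUl _ _)) /= addr0.
have [p2|_] := boolP (path p \subset S2).
  by rewrite (subset_trans p2 (subsetUr _ _)) /= !addr0 add0r.
by rewrite /= !andbT !addr0 add0r.
Qed.

Hypothesis w_gt0 : forall v, 0 < w v.

Lemma path_weight_supermodular S1 S2 :
  path_weight S1 + path_weight S2 <= path_weight (S1 :|:
    S2) + path_weight (S1 :&: S2).
Proof.
by rewrite path_weight_modular lerDl sumr_ge0 // => p _; rewrite mulr_ge0 // ltW.
Qed.

Lemma path_weight_supermodular_lt S1 S2 u v : sep t u v \subset S1 :|: S2 ->
  ~~ (sep t u v \subset S1) -> ~~ (sep t u v \subset S2) ->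
  path_weight S1 + path_weight S2 < path_weight (S1 :|: S2) + path_weight (S1 :&:
    S2).
Proof.
move=> uv uv1 uv2; rewrite path_weight_modular ltrDl.
apply: (@sumr_gt0_ex _ _ _ _ (u, v)) => [p _||]; rewrite ?mulr_gt0 //;
  first by rewrite mulr_ge0 // ltW.
rewrite uv uv1 uv2 !andbT /= -(sep_eq0 t); apply: contraNneq uv1 => ->;
  exact: sub0set.
Qed.

End Weights.

(** * Coordinate sums and the polyhedron of the nest inequalities *)

Section CoordSum.
Variables (R : realFieldType) (n : nat).
Implicit Types (S : {set 'I_n}) (x y : 'rV[R]_n).

Definition coord_sum S x : R := \sum_(i in S) x 0 i.

Lemma coord_sumD S x y : coord_sum S (x + y) = coord_sum S x + coord_sum S y.
Proof. by rewrite /coord_sum -big_split; apply: eq_bigr => i _; rewrite mxE. Qed.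

Lemma coord_sumZ S a x : coord_sum S (a *: x) = a * coord_sum S x.
Proof. by rewrite /coord_sum big_distrr; apply: eq_bigr => i _; rewrite mxE. Qed.

Lemma coord_sumB S x y : coord_sum S (x - y) = coord_sum S x - coord_sum S y.
Proof. by rewrite coord_sumD -scaleN1r coord_sumZ mulN1r. Qed.

Lemma coord_sum_lincomb S k (a : 'I_k -> R) (p : 'I_k -> 'rV[R]_n) :
  coord_sum S (\sum_j a j *: p j) = \sum_j a j * coord_sum S (p j).
Proof.
elim/big_ind2: _ => [|x u y v <- <-|j _]; rewrite ?coord_sumD ?coord_sumZ //.
by rewrite /coord_sum big1 // => i _; rewrite mxE.
Qed.

Lemma coord_sumUI S1 S2 x :
  coord_sum (S1 :|: S2) x + coord_sum (S1 :&: S2) x =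
    coord_sum S1 x + coord_sum S2 x.
Proof.
rewrite /coord_sum !(big_mkcond (fun i => i \in _)) -!big_split /=;
  apply: eq_bigr => i _.
by rewrite !inE; case: (i \in S1) (i \in S2) => [] [] /=; rewrite ?addr0 ?add0r.
Qed.

Lemma coord_sum0 x : coord_sum set0 x = 0.
Proof. by rewrite /coord_sum big_set0. Qed.

End CoordSum.

Section Inequalities.
Variables (R : realFieldType) (n : nat) (t : PT n.+1) (w : 'I_n.+1 -> int).
Hypothesis w_gt0 : forall v, 0 < w v.
Implicit Types (i j : 'I_n) (N S : {set 'I_n}) (x y z : 'rV[R]_n).

Local Notation pw S := ((path_weight t w S)%:~R : R).

(** The factor 2 matches the ordered pairs counted by [path_weight]. *)
Definition is_tight x S : bool := 2 * coord_sum S x == pw S.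

Definition nest_ineqs x : Prop :=
  is_tight x setT /\ forall N, nest t N -> pw N <= 2 * coord_sum N x.

Definition tight_nests x : {set {set 'I_n}} := [set N | nest t N && is_tight x N].

(** Uncrossing: the union is a nest because both nests touch [v], and the intersection is empty or a
    nest. Their inequalities bound the sum of the two tight values from below, while a path through
    [a] and [b] makes supermodularity strict. *)
Lemma tight_nests_cross x N1 N2 v i1 i2 a b : nest_ineqs x ->
  N1 \in tight_nests x -> N2 \in tight_nests x ->
  i1 \in N1 -> i2 \in N2 -> incident t v i1 -> incident t v i2 ->
  a \in N1 -> a \notin N2 -> b \in N2 -> b \notin N1 -> False.
Proof.
move=> [_ x_ge]; rewrite !inE => /andP[n1 /eqP t1] /andP[n2 /eqP t2].
move=> i1N i2N vi1 vi2 a1 a2 b2 b1.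
have [u [u' [ua u'b a_sep b_sep]]] :
  exists u u', [/\ incident t u a, incident t u' b,
    a \in sep t u u' & b \in sep t u u'].
  by apply: sep_endpoints; apply: contraNneq b1 => <-.
have nU : nest t (N1 :|: N2) by exact: nest_setU vi1 i2N vi2.
have := @path_weight_supermodular_lt _ t _ w_gt0 N1 N2 u u'.
have -> : sep t u u' \subset N1 :|: N2.
  by apply: nest_sep ua u'b => //; rewrite inE ?a1 ?b2 ?orbT.
have -> : ~~ (sep t u u' \subset N1) by apply/subsetPn; exists b.
have -> : ~~ (sep t u u' \subset N2) by apply/subsetPn; exists a.
move=> /(_ isT isT isT); rewrite -(ltr_int R) !intrD -t1 -t2 -mulrDr -coord_sumUI mulrDr.
apply/negP; rewrite -leNgt; apply: lerD; first exact: x_ge.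
have [->|N0] := eqVneq (N1 :&: N2) set0;
  first by rewrite path_weight_set0 coord_sum0 mulr0.
exact/x_ge/nest_setI.
Qed.

Lemma nesting_tight_nests x : nest_ineqs x -> nesting t (tight_nests x).
Proof.
move=> x_in; apply/nestingP; split.
- by move=> N; rewrite inE => /andP[].
- by move=> n_gt0; rewrite inE nest_setT //; case: x_in.
- move=> N1 N2 T1 T2; have [|] := boolP (N1 \subset N2); first by constructor 1.
  case/subsetPn=> a a1 a2; have [|] := boolP (N2 \subset N1);
    first by constructor 2.
  case/subsetPn=> b b2 b1; have [|] := boolP [disjoint N1 & N2];
    first by constructor 3.
  rewrite -setI_eq0 => /set0Pn[e /setIP[e1 e2]].
  by case: (tight_nests_cross x_in T1 T2 e1 e2 (incident_upper t e)
    (incident_upper t e) a1 a2 b2 b1).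
- move=> N1 N2 i j T1 T2 dis i1 j2; apply/negP => /andP[_ /existsP[v /andP[vi vj]]].
  have i2 := disjointFr dis i1; have j1 := disjointFl dis j2.
  by case: (tight_nests_cross x_in T1 T2 i1 j2 vi vj i1 (negbT i2) j2 (negbT j1)).
Qed.

(** Along the ray from [y] through [x] the total is constant, so some coordinate decreases;
    singletons being nests, some inequality must eventually fail. Stop at the first one to become
    tight. The nests tight at [x] are tight at [y] too, hence on the whole ray. *)
Lemma ray_exit x y : nest_ineqs x -> nest_ineqs y -> x != y ->
  tight_nests x \subset tight_nests y ->
  exists2 s, 0 < s & let z := x + s *: (x - y) in
    nest_ineqs z /\ tight_nests x \proper tight_nests z.
Proof.
move=> [x_tot x_ge] [y_tot y_ge] neq_xy /subsetP xy.
pose d N := coord_sum N (x - y).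
have d_tot : d setT = 0.
  by move: x_tot y_tot; rewrite /is_tight /d coord_sumB => /eqP <- /eqP; lra.
have d_tight N : N \in tight_nests x -> d N = 0.
  move=> xN; have := xy _ xN; move: xN;
    rewrite !inE => /andP[_ /eqP xN] /andP[_ /eqP].
  by rewrite -xN /d coord_sumB; lra.
have [i di] : exists i, d [set i] < 0.
  apply/existsP; apply: contraNT neq_xy => /existsPn d_ge; rewrite -subr_eq0.
  have dE i : d [set i] = (x - y) 0 i by rewrite /d /coord_sum big_set1.
  have xy_ge i : i \in [set: 'I_n] -> 0 <= (x - y) 0 i by rewrite -dE leNgt d_ge.
  apply/eqP/rowP=> i; rewrite [RHS]mxE.
  have /eqP := d_tot; rewrite /d /coord_sum psumr_eq0 // => /allP/(_ i).
  by rewrite mem_index_enum inE => /(_ isT)/eqP.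
(* For [d N < 0], [ratio N] is the parameter at which the inequality of [N] becomes tight. *)
pose slack N := 2 * coord_sum N x - pw N; pose ratio N := slack N / (- (2 * d N)).
have P_i : nest t [set i] && (d [set i] < 0) by rewrite nest_set1.
case: (@Order.TotalTheory.arg_minP _ _ _ [set i] [pred N | nest t N &&
  (d N < 0)] ratio P_i).
move=> N0 /= /andP[N0_nest dN0] N0_min; pose s := ratio N0.
have slack_gt0 : 0 < slack N0.
  have := x_ge _ N0_nest; rewrite -subr_ge0 le_eqVlt => /orP[|//];
    rewrite eq_sym subr_eq0 => N0_tight.
  have N0x : N0 \in tight_nests x by rewrite inE N0_nest.
  by move: dN0; rewrite d_tight // ltxx.
have s_gt0 : 0 < s by rewrite divr_gt0 // oppr_gt0 pmulr_rlt0.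
have zE N : 2 * coord_sum N (x + s *: (x - y)) = 2 * coord_sum N x + s * (2 * d N).
  by rewrite coord_sumD coord_sumZ -/(d N); lra.
exists s => //=; split; first split.
- by rewrite /is_tight zE d_tot !mulr0 addr0.
- move=> N N_nest; rewrite zE; have [d_ge|d_lt] := leP 0 (d N).
    by apply: le_trans (x_ge _ N_nest) _; rewrite lerDl; apply: mulr_ge0;
      [exact: ltW|lra].
  have := N0_min N; rewrite /= N_nest d_lt => /(_ isT); rewrite -/s ler_pdivlMr;
    last by lra.
  by rewrite /slack; lra.
apply/properP; split.
  apply/subsetP=> N xN; move: (xN); rewrite !inE => /andP[-> /= /eqP xN_t].
  by rewrite /is_tight zE (d_tight _ xN) !mulr0 addr0 xN_t.
exists N0; rewrite inE N0_nest /=; last by rewrite /is_tight -subr_eq0 lt0r_neq0.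
rewrite /is_tight zE -subr_eq0; apply/eqP; rewrite /s /ratio /slack.
by have := ltr0_neq0 dN0; set dd := d N0 => dd0; field.
Qed.

End Inequalities.

(** * Weights of contracted nests *)

Section ContractedWeights.
Variables (n : nat) (t : PT n.+1) (w : 'I_n.+1 -> int).
Hypothesis w_gt0 : forall v, 0 < w v.
Implicit Types (N A S : {set 'I_n}) (NN : {set {set 'I_n}}).

Lemma incident_ex m (s : PT m.+1) (b : 'I_m.+1) : (0 < m)%N ->
  exists i, incident s b i.
Proof.
move=> m_gt0; have [->|[i ->]] := vertexP b; last by exists i;
  exact: incident_upper.
exists (Ordinal m_gt0); apply/orP; right; rewrite -val_eqE /= eq_sym -leqn0.
exact: lower_le (Ordinal m_gt0).
Qed.

(** Contract the edges outside [A] and give each new vertex the weight of its fibre in [t(N)]. Pairs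
    from different fibres are those whose path in [N] meets [A]; pairs from one fibre have their
    path in [N :\: A] and are subtracted. *)
Lemma path_weight_contraction N A : nest t N -> A \subset N -> A != set0 ->
  exists (s : PT #|A|.+1) (sigma : 'I_#|A| -> 'I_n) (a : 'I_#|A|.+1 -> int),
    [/\ injective sigma, [set sigma i | i : 'I_#|A|] = A, forall b, 0 < a b
      & forall S : {set 'I_#|A|}, path_weight s a S =
          path_weight t w (sigma @: S :|: (N :\: A)) - path_weight t w (N :\: A)].
Proof.
move=> N_nest /subsetP AN A_neq0;
  have [s [sigma [q [sigma_inj sigma_in sepE]]]] := tree_contraction t A.
have sigma_img : [set sigma i | i : 'I_#|A|] = A.
  apply/eqP; rewrite eqEcard card_imset // card_ord leqnn andbT.
  by apply/subsetP=> _ /imsetP[i _ ->].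
pose a b := \sum_(u in nest_verts t N | q u == b) w u.
exists s, sigma, a; split=> // [b|S].
  (* Every fibre meets [t(N)]: an edge [i] at [b] lifts to [sigma i] in [N], and one end of
     [sigma i] maps to [b]. *)
  have [i bi] : exists i, incident s b i by apply: incident_ex; rewrite card_gt0.
  have ends u v : sep s u v = [set i] -> b = u \/ b = v.
    move=> uv; have neq : u != v by rewrite -(sep_eq0 s) uv -cards_eq0 cards1.
    have ui : incident s u i.
      have := sep_incident neq (subxx (sep s u v));
        rewrite uv inE => /exists_inP[j].
      by rewrite inE => /eqP->.
    have vi : incident s v i.
      rewrite eq_sym in neq; have := sep_incident neq (subxx (sep s v u)).
      by rewrite sepC uv inE => /exists_inP[j]; rewrite inE => /eqP->.
    move: bi ui vi => /orP[]/eqP-> /orP[]/eqP Eu /orP[]/eqP Ev;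
      by move: neq; rewrite Eu Ev ?eqxx; auto.
  have [u uN qu] : exists2 u, u \in nest_verts t N & q u = b.
    have sep_i : sep s (q (upper (sigma i))) (q (lower t (sigma i))) = [set i].
      by apply/setP=> j; rewrite sepE sep_edge !inE (inj_eq sigma_inj).
    have [->|->] := ends _ _ sep_i;
      [exists (upper (sigma i))|exists (lower t (sigma i))] => //;
      rewrite inE; apply/exists_inP; exists (sigma i); rewrite ?AN //.
      exact: incident_upper.
    by rewrite /incident eqxx orbT.
  by apply: (@sumr_gt0_ex _ _ _ _ u) => [v _||]; rewrite ?uN ?qu ?eqxx // ltW.
transitivity (\sum_(p : 'I_n.+1 * 'I_n.+1 | [&& p.1 \in nest_verts t N, p.2 \in nest_verts t N,
    q p.1 != q p.2 & sep s (q p.1) (q p.2) \subset S]) w p.1 * w p.2).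
  rewrite (partition_big (fun p => (q p.1, q p.2)) (fun b =>
    (b.1 != b.2) && (sep s b.1 b.2 \subset S))) /=.
    apply: eq_bigr => -[b b'] /= bb'; rewrite /a big_distrlr pair_big /=.
    apply: eq_bigl => -[u v] /=; rewrite xpair_eqE.
    case: eqP => [->|_]; last by rewrite !andbF.
    case: eqP => [->|_]; last by rewrite !andbF.
    by rewrite bb' !andbT.
  by move=> p /and4P[_ _ -> ->].
have sub p : (p.1 != p.2) && (sep t p.1 p.2 \subset N :\: A) ->
    (p.1 != p.2) && (sep t p.1 p.2 \subset sigma @: S :|: (N :\: A)).
  by case/andP=> -> pN; apply: subset_trans pN (subsetUr _ _).
rewrite {1}/path_weight (sum_pred_sub _ sub) addrC addKr;
  apply: eq_bigl => -[u v] /=.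
apply/and4P/idP => [[uN vN q_neq qS]|].
  have uvN : sep t u v \subset N.
    move: uN vN; rewrite !inE => /exists_inP[i iN ui] /exists_inP[j jN vj].
    exact: nest_sep ui vj.
  move: q_neq; rewrite -(sep_eq0 s) => /set0Pn[i]; rewrite sepE => i_uv.
  have neq : u != v by rewrite -(sep_eq0 t); apply/set0Pn; exists (sigma i).
  rewrite neq /=; apply/andP; split; last by apply/subsetPn; exists (sigma i);
    rewrite // inE sigma_in.
  apply/subsetP=> e e_uv; rewrite !inE (subsetP uvN _ e_uv) andbT.
  have [eA|_] := boolP (e \in A); last by rewrite orbT.
  have /imsetP[j _ def_e] : e \in [set sigma i | i : 'I_#|A|] by rewrite sigma_img.
  rewrite orbF def_e imset_f //.
  by apply: (subsetP qS); rewrite sepE -def_e.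
case/andP=> /andP[neq uv_sub]; rewrite neq /= => /subsetPn[e e_uv e_notin].
have uvN : sep t u v \subset N.
  apply: subset_trans uv_sub _; rewrite subUset subsetDl andbT.
  by apply/subsetP=> _ /imsetP[i _ ->]; rewrite AN.
have /imsetP[i iS def_e] : e \in sigma @: S.
  by have /setUP[//|] := subsetP uv_sub _ e_uv; rewrite (negPf e_notin).
split; first exact: sep_incident uvN.
- by apply: (@sep_incident _ _ v u); rewrite 1?sepC // eq_sym.
- by rewrite -(sep_eq0 s); apply/set0Pn; exists i; rewrite sepE -def_e.
apply/subsetP=> j; rewrite sepE => /(subsetP uv_sub); rewrite !inE sigma_in /= orbF.
by case/imsetP=> k kS /sigma_inj->.
Qed.

(** For [N] in [NN], the edges of [N] in no smaller nest of [NN]; they become the coordinates of the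
    factor contributed by [N]. *)
Definition own_edges NN N : {set 'I_n} := [set i | min_nest NN i == N].

Lemma own_edges_sub NN N : own_edges NN N \subset N.
Proof. by apply/subsetP=> i; rewrite inE => /eqP <-; exact: mem_min_nest. Qed.

Lemma own_edges_neq0 NN N : nesting t NN -> N \in NN -> own_edges NN N != set0.
Proof.
move=> NN_nesting; rewrite -{1}(level_nesting_codepth NN_nesting) =>
  /imsetP[g _ ->].
by apply/set0Pn; exists g; rewrite inE level_nest_codepth.
Qed.

Lemma inner_edgesE NN N : nesting t NN -> N \in NN ->
  N :\: own_edges NN N = \bigcup_(N' in NN | N' \proper N) N'.
Proof.
move=> NN_nesting NN_N; apply/setP=> i; rewrite !inE;
  apply/andP/bigcupP => [[neq iN]|[N' /andP[NN_N' lt_N'] iN']].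
  exists (min_nest NN i); last exact: mem_min_nest.
  by rewrite (min_nest_in i NN_nesting) properEneq neq min_nest_sub.
split; last exact: subsetP (proper_sub lt_N') _ iN'.
apply/eqP=> eq_N; have := proper_subn lt_N'; by rewrite -{1}eq_N min_nest_sub.
Qed.

(* A path is charged to the smallest nest of NN containing it. *)
Lemma path_weight_layers NN S : nesting t NN ->
  path_weight t w S <= \sum_(N in NN)
    (path_weight t w ((S :&: own_edges NN N) :|: (N :\: own_edges NN N)) -
     path_weight t w (N :\: own_edges NN N)).
Proof.
move=> NN_nesting.
pose charged N (p : 'I_n.+1 * 'I_n.+1) := [&& p.1 != p.2,
  sep t p.1 p.2 \subset (S :&: own_edges NN N) :|: (N :\: own_edges NN N)
  & ~~ (sep t p.1 p.2 \subset N :\: own_edges NN N)].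
have -> : \sum_(N in NN)
    (path_weight t w ((S :&: own_edges NN N) :|: (N :\: own_edges NN N)) -
     path_weight t w (N :\: own_edges NN N)) =
    \sum_(p : 'I_n.+1 * 'I_n.+1) \sum_(N in NN | charged N p) w p.1 * w p.2.
  rewrite (exchange_big_dep (fun N => N \in NN)) /=; last by move=> p N _ /andP[].
  apply: eq_bigr => N NN_N; set C := N :\: _; set U := _ :|: C.
  have sub p : (p.1 != p.2) && (sep t p.1 p.2 \subset C) ->
      (p.1 != p.2) && (sep t p.1 p.2 \subset U).
    by case/andP=> -> pC; apply: subset_trans pC (subsetUr _ _).
  rewrite {1}/path_weight (sum_pred_sub _ sub) addrC addKr; apply: eq_bigl => p.
  by rewrite NN_N /charged -/C -/U; case: (p.1 != p.2).
rewrite /path_weight big_mkcond; apply: ler_sum => p _;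
  have pos : 0 <= w p.1 * w p.2 by rewrite mulr_ge0 // ltW.
case: ifPn => [/andP[p_neq pS]|_]; last exact: sumr_ge0.
have [i ip pi] := path_top t (codepth NN) p_neq.
have : sep t p.1 p.2 \subset min_nest NN i by rewrite -(level_nest_codepth _
  NN_nesting) level_nest_sep.
set N := min_nest NN i => pN; have NN_N : N \in NN := min_nest_in i NN_nesting.
have N_charged : (N \in NN) && charged N p.
  rewrite NN_N /charged p_neq /=; apply/andP; split; last first.
    by apply/subsetPn; exists i; rewrite // !inE eqxx.
  apply/subsetP=> e ep; rewrite !inE (subsetP pS) // (subsetP pN) //= andbT;
    exact: orbN.
by rewrite (bigD1 N) //= lerDl sumr_ge0.
Qed.

End ContractedWeights.

From mathcomp Require Import all_classical all_reals.

Local Open Scope classical_set_scope.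
Local Open Scope ring_scope.

(** * The Loday polytope and its faces *)

Section Convexity.
Variables (R : realType) (m : nat).
Implicit Types (S : set 'rV[R]_m).

Lemma sub_conv_hull S : S `<=` conv_hull S.
Proof.
move=> x Sx; exists 1%N, (fun=> x), (fun=> 1); split=> //.
  by rewrite big_ord1.
by rewrite big_ord1 scale1r.
Qed.

Lemma conv_hull_convex S x y (a b : R) : conv_hull S x -> conv_hull S y ->
  0 <= a -> 0 <= b -> a + b = 1 -> conv_hull S (a *: x + b *: y).
Proof.
move=> [k1 [p1 [a1 [Sp1 a1_ge a1_sum ->]]]] [k2 [p2 [a2 [Sp2 a2_ge a2_sum ->]]]]
  a_ge b_ge ab.
exists (k1 + k2)%N, (fun i => match fintype.split i with inl j => p1 j | inr j =>
  p2 j end),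
  (fun i => match fintype.split i with inl j => a * a1 j | inr j => b * a2 j end).
have splitL j : fintype.split (lshift k2 j) = inl j :> 'I_k1 + 'I_k2 :=
  unsplitK (inl j).
have splitR j : fintype.split (rshift k1 j) = inr j :> 'I_k1 + 'I_k2 :=
  unsplitK (inr j).
split.
- by move=> i; case: (fintype.split i).
- by move=> i; case: (fintype.split i) => j; rewrite mulr_ge0.
- rewrite big_split_ord /=; under eq_bigr do rewrite splitL.
  under [X in _ + X]eq_bigr do rewrite splitR.
  by rewrite -!big_distrr /= a1_sum a2_sum !mulr1.
rewrite big_split_ord /= !scaler_sumr; congr (_ + _); apply: eq_bigr => j _.
  by rewrite splitL scalerA.
by rewrite splitR scalerA.
Qed.

Lemma dotpD (c x y : 'rV[R]_m) : dotp c (x + y) = dotp c x + dotp c y.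
Proof. by rewrite /dotp -big_split; apply: eq_bigr => i _; rewrite mxE mulrDr. Qed.

Lemma dotpZ (c x : 'rV[R]_m) a : dotp c (a *: x) = a * dotp c x.
Proof. by rewrite /dotp big_distrr; apply: eq_bigr => i _; rewrite mxE mulrCA. Qed.

End Convexity.

Section LodayPolytope.
Variables (R : realType) (n : nat) (t : PT n.+1) (w : 'I_n.+1 -> int).
Hypothesis w_gt0 : forall v, 0 < w v.
Implicit Types (N S : {set 'I_n}) (NN : {set {set 'I_n}}) (x y z : 'rV[R]_n).

Local Notation pw S := ((path_weight t w S)%:~R : R).
Local Notation P := (loday R t w).
Local Notation pt := (nesting_point R t w).
Local Notation nest_ineqs := (nest_ineqs t w).
Local Notation tight := (is_tight t w).
Local Notation tight_nests := (tight_nests t w).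

Lemma coord_sum_point NN S :
  2 * coord_sum S (pt NN) = (2 * (\sum_(i in S) nesting_vector t w NN 0%R i))%:~R.
Proof.
rewrite intrM; congr (_ * _); rewrite /coord_sum rmorph_sum; apply: eq_bigr => i _.
by rewrite !mxE.
Qed.

Lemma loday_point NN : maximal_nesting t NN -> P (pt NN).
Proof. by move=> NN_max; apply: sub_conv_hull; exists NN. Qed.

Lemma tight_point NN N : maximal_nesting t NN -> N \in NN -> tight (pt NN) N.
Proof.
move=> /maximal_nestingP[c c_inj ->] NN_N.
by rewrite /tight coord_sum_point level_vector_eq_nest.
Qed.

Lemma tight_point_nest NN N : maximal_nesting t NN -> nest t N ->
  tight (pt NN) N = (N \in NN).
Proof.
move=> NN_max N_nest; apply/idP/idP; last exact: tight_point.
have [c c_inj def_NN] := maximal_nestingP NN_max.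
apply: contraTT; rewrite def_NN => /(level_vector_gt c_inj w_gt0 N_nest).
by rewrite /tight coord_sum_point eqr_int => /gt_eqF->.
Qed.

(* P is a base polytope: the inequalities hold for every set of edges, not    *)
(* only for nests.                                                            *)
Lemma loday_total x : P x -> tight x [set: 'I_n]%SET.
Proof.
case=> k [p [a [Pp _ a_sum ->]]]; rewrite /tight coord_sum_lincomb big_distrr /=.
rewrite (eq_bigr (fun j => a j * pw [set: 'I_n]%SET)) => [|j _].
  by rewrite -big_distrl a_sum /= mul1r.
have [NN NN_max <-] := Pp j; have [c c_inj ->] := maximal_nestingP NN_max.
rewrite mulrCA coord_sum_point -(level_vector_total _ _ c_inj);
  congr (_ * (2 * _)%:~R).
by apply: eq_bigl => i; rewrite inE.
Qed.

Lemma loday_ge x S : P x -> pw S <= 2 * coord_sum S x.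
Proof.
case=> k [p [a [Pp a_ge a_sum ->]]]; rewrite coord_sum_lincomb big_distrr /=.
have -> : pw S = \sum_i a i * pw S by rewrite -big_distrl a_sum /= mul1r.
apply: ler_sum => j _ /=; rewrite mulrCA ler_wpM2l //.
have [NN NN_max <-] := Pp j; have [c c_inj ->] := maximal_nestingP NN_max.
by rewrite coord_sum_point ler_int level_vector_ge.
Qed.

Lemma loday_nest_ineqs x : P x -> nest_ineqs x.
Proof. by move=> Px; split=> [|N _]; [exact: loday_total|exact: loday_ge]. Qed.

(** By induction on how many sets are not tight nests at [x]: [x] lies between the vertex of a
    maximal nesting containing its tight nests and the exit point [z] of the ray from that vertex,
    where more nests are tight. *)
Lemma nest_ineqs_loday x : nest_ineqs x -> P x.
Proof.
have [k] := ubnP (#|[set: {set 'I_n}]%SET| - #|tight_nests x|)%N.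
elim: k x => // k IH x; rewrite ltnS => le_k x_in.
have [NN NN_max sub] := maximal_nesting_ex (nesting_tight_nests w_gt0 x_in).
have [->|neq] := eqVneq x (pt NN); first exact: loday_point.
have v_in := loday_nest_ineqs (loday_point NN_max).
have xv : tight_nests x \subset tight_nests (pt NN).
  apply/fintype.subsetP=> N xN; have NN_N := fintype.subsetP sub _ xN.
  by move: xN; rewrite !inE => /andP[-> _] /=; exact: tight_point.
have [s s_gt0 /= [z_in lt_xz]] := ray_exit x_in v_in neq xv.
set z := x + _ in z_in lt_xz.
have Pz : P z.
  apply: IH z_in; have := proper_card lt_xz.
  have := subset_leq_card (finset.subsetT (tight_nests z)); lia.
have s1 : 1 + s != 0 by rewrite lt0r_neq0 // ltr_wpDl.
have -> : x = (1 + s)^-1 *: z + (s / (1 + s)) *: pt NN.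
  apply/rowP=> i; by rewrite /z !mxE; field.
rewrite /loday; apply: conv_hull_convex => //; first exact: loday_point.
- by rewrite invr_ge0 addr_ge0 // ltW.
- by rewrite divr_ge0 ?addr_ge0 // ltW.
by field.
Qed.

Lemma halfspaceE N x : nest t N ->
  halfspace R t w N x <-> pw N <= 2 * coord_sum N x.
Proof.
move=> N_nest; rewrite /halfspace /= -path_weight_nest // intrM ler_pM2l //.
Qed.

Lemma boundaryE N x : nest t N -> boundary R t w N x <-> tight x N.
Proof.
move=> N_nest; rewrite /boundary /= /tight -path_weight_nest // intrM.
rewrite -subr_eq0 -mulrBr mulf_eq0 (negPf (_ :
  2 != 0 :> R)) ?pnatr_eq0 //= subr_eq0.
by split=> /eqP.
Qed.

Lemma hyperplaneE x : hyperplane R w x <-> tight x [set: 'I_n]%SET.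
Proof.
rewrite /hyperplane /= /tight -path_weight_setT intrM.
rewrite -subr_eq0 -mulrBr mulf_eq0 (negPf (_ :
  2 != 0 :> R)) ?pnatr_eq0 //= subr_eq0.
have -> : coord_sum [set: 'I_n]%SET x = \sum_i x 0%R i by apply: eq_bigl => i;
  rewrite inE.
by split=> /eqP.
Qed.

Lemma nest_ineqs_halfspaces x : nest_ineqs x <->
  (hyperplane R w `&` \bigcap_(N in [set N | nontrivial_nest t N]) halfspace R t w N) x.
Proof.
split=> [[x_tot x_ge]|[x_tot x_ge]].
  by split; [exact/hyperplaneE|move=> N /= /andP[N_nest _]; apply/halfspaceE;
    rewrite ?x_ge].
move/hyperplaneE: x_tot => x_tot; split=> // N N_nest.
have [->|N_nontriv] := eqVneq N [set: 'I_n]%SET; first by rewrite (eqP x_tot).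
by apply/halfspaceE => //; apply: x_ge; rewrite /= /nontrivial_nest N_nest.
Qed.

Definition tight_face NN : set 'rV[R]_n :=
  [set x | P x /\ forall N, N \in NN -> tight x N].

(** Minus the sum of the left-hand sides over [NN] exposes this face: its gap to the bound is a sum
    of nonnegative slacks, zero only if all of them vanish. *)
Lemma face_tight_face NN : face P (tight_face NN).
Proof.
pose c : 'rV[R]_n := \row_i - (2 * #|[set N in NN | i \in N]%SET|%:R).
have dotE x : dotp c x = - \sum_(N in NN) 2 * coord_sum N x.
  rewrite /dotp -big_distrr /=;
    under [X in _ = - (_ * X)]eq_bigr do rewrite /coord_sum big_mkcond /=.
  rewrite exchange_big /= big_distrr /= -sumrN; apply: eq_bigr => i _.
  rewrite mxE mulNr -big_mkcondr /= sumr_const -[x 0%R i *+ _]mulr_natl mulrA;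
    congr (- (_ * _%:R * _)).
  by apply: eq_card => N; rewrite inE.
have slack x : - \sum_(N in NN) pw N - dotp c x =
  \sum_(N in NN) (2 * coord_sum N x - pw N).
  by rewrite dotE opprK addrC -sumrB.
exists c, (- \sum_(N in NN) pw N); split.
  move=> x Px; rewrite -subr_ge0 slack sumr_ge0 // => N _; rewrite subr_ge0;
    exact: loday_ge.
apply/seteqP; split=> x [Px]; move=> x_tight; split=> //.
  apply/eqP; rewrite eq_sym -subr_eq0 slack big1 // => N /x_tight/eqP->;
    exact: subrr.
move=> N NN_N; have := slack x; rewrite x_tight subrr => /esym/eqP.
rewrite psumr_eq0 => [/allP/(_ N)|N' _]; last by rewrite subr_ge0; exact: loday_ge.
by rewrite mem_index_enum NN_N subr_eq0 => /(_ isT).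
Qed.

Lemma tight_face_neq0 NN : nesting t NN -> tight_face NN !=set0.
Proof.
move=> /maximal_nesting_ex[NN' NN'_max /fintype.subsetP sub].
exists (pt NN'); split; first exact: loday_point.
by move=> N /sub; exact: tight_point.
Qed.

(** If a nest of [NN2] is missing from [NN1], some maximal nesting contains [NN1] and avoids it; the
    corresponding vertex is in the first face only. *)
Lemma tight_face_sub NN1 NN2 : nesting t NN1 -> nesting t NN2 ->
  tight_face NN1 `<=` tight_face NN2 <-> NN2 \subset NN1.
Proof.
move=> nest1 nest2; split=> [sub|/fintype.subsetP sub x [Px x1]]; last first.
  by split=> // N /sub; exact: x1.
apply/fintype.subsetP=> N N2; apply: contraT => N1.
have /nestingP[/(_ _ N2) N_nest _ _ _] := nest2.
have [NN' [NN'_max sub1 N'_notin]] := maximal_nesting_avoid nest1 N_nest N1.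
have [|_ /(_ _ N2)] := sub (pt NN');
  last by rewrite tight_point_nest // (negPf N'_notin).
split; first exact: loday_point.
by move=> N0 /(fintype.subsetP sub1); exact: tight_point.
Qed.

(** Take [x0] in the face with fewest tight nests. For [y] in the face, the nests tight at the
    midpoint are tight at both ends, so by minimality those of [x0] are tight at [y]. Conversely, if
    they are tight at a point [y] of the polytope, the segment from [y] to [x0] extends beyond [x0]
    inside the polytope, which forces [dotp c y] up to the maximum [d]. *)
Lemma loday_face_tight F : face P F -> F !=set0 ->
  exists2 NN, nesting t NN & F = tight_face NN.
Proof.
move=> [c [d [c_le ->]]] [x1 [Px1 cx1]].
have ex_k : exists k, `[< exists2 x, P x /\ dotp c x = d & #|tight_nests x| = k >].
  by exists #|tight_nests x1|; apply/asboolP; exists x1.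
case: (ex_minnP ex_k) => k /asboolP[x0 [Px0 cx0] card_x0] k_min.
have x0_in := loday_nest_ineqs Px0.
exists (tight_nests x0); first exact: nesting_tight_nests.
apply/seteqP; split=> y.
  move=> [Py cy]; split=> // N; pose z := 2^-1 *: x0 + 2^-1 *: y.
  have z_in : P z by rewrite /loday; apply: conv_hull_convex;
    rewrite ?invr_ge0 //; field.
  have cz : dotp c z = d by rewrite dotpD !dotpZ cx0 cy; field.
  have zE S : 2 * coord_sum S z =
    2^-1 * (2 * coord_sum S x0) + 2^-1 * (2 * coord_sum S y).
    by rewrite coord_sumD !coord_sumZ; field.
  have z_tight S : tight z S -> tight x0 S /\ tight y S.
    rewrite /tight zE => /eqP z_eq; have := loday_ge S Px0; have := loday_ge S Py.
    by split; apply/eqP; lra.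
  have zx : tight_nests z \subset tight_nests x0.
    by apply/fintype.subsetP=> S; rewrite !inE => /andP[-> /z_tight[-> _]].
  have /eqP <- : tight_nests z == tight_nests x0.
    by rewrite eqEcard zx card_x0 k_min //; apply/asboolP; exists z.
  by rewrite inE => /andP[_ /z_tight[]].
move=> [Py y_tight]; split=> //; apply/eqP; rewrite eq_le c_le //=.
have [->|neq] := eqVneq y x0; first by rewrite cx0.
have xy : tight_nests x0 \subset tight_nests y.
  by apply/fintype.subsetP=> N x0N; move: (x0N);
    rewrite !inE y_tight // => /andP[->].
rewrite eq_sym in neq.
have [s s_gt0 /= [z_in _]] := ray_exit x0_in (loday_nest_ineqs Py) neq xy.
have := c_le _ (nest_ineqs_loday z_in);
  rewrite dotpD dotpZ -scaleN1r dotpD dotpZ cx0.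
have -> : d + s * (d + -1 * dotp c y) = d - s * (dotp c y - d) by ring.
by rewrite gerBl pmulr_rge0 // subr_ge0.
Qed.

Lemma loday_face_lattice : exists f : nesting_lattice t -> set 'rV[R]_n,
  set_bij [set: nesting_lattice t] (face P) f /\
  (forall a b, f a `<=` f b <-> nesting_le b a).
Proof.
pose f (a : nesting_lattice t) :=
  if a is Some NN then tight_face (val NN) else set0.
have f_le a b : f a `<=` f b <-> nesting_le b a.
  case: a b => [[NN1 nest1]|] [[NN2 nest2]|] /=.
  - exact: tight_face_sub.
  - by split=> // sub; have [x x1] := tight_face_neq0 nest1; case: (sub x x1).
  - by split=> // _ x [].
  - by split=> // _ x [].
exists f; split=> //; split.
- move=> [NN|] _ /=; first exact: face_tight_face.
  (* [None] goes to the empty face, exposed by the zero functional with bound 1. *)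
  exists 0, 1; split=> [x _|]; first by rewrite /dotp big1 ?ler01 // => i _;
    rewrite mxE mul0r.
  apply/esym/seteqP; split=> x // [_]; rewrite /dotp big1 => [/eqP|i _];
    last by rewrite mxE mul0r.
  by rewrite eq_sym oner_eq0.
- move=> a b _ _ fab.
  have : nesting_le a b by apply/f_le; rewrite fab.
  have : nesting_le b a by apply/f_le; rewrite fab.
  case: a b {fab} => [NN1|] [NN2|] //= le12 le21; congr Some; apply/val_inj/eqP.
  by rewrite finset.eqEsubset le12 le21.
- move=> F F_face; have [F0|/eqP/set0P F_neq0] := pselect (F = set0).
    by exists None.
  have [NN NN_nest ->] := loday_face_tight F_face F_neq0.
  by exists (Some (exist _ NN NN_nest)).
Qed.

End LodayPolytope.

(** * Dimension of the factors of a proper face *)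

Section AffineDimension.
Variable R : realType.

(** Affinely independent points of [B] embed in the face, and a point [z] of [P] off the supporting
    hyperplane adds one dimension. *)
Lemma affdim_face_lt (m n : nat) (B : set 'rV[R]_m) (P F : set 'rV[R]_n)
    (emb : 'rV[R]_m -> 'rV[R]_n) (E : 'M[R]_(m, n)) :
  face P F -> F <> P -> row_free E ->
  (forall x y, emb x - emb y = (x - y) *m E) -> (forall x, B x -> F (emb x)) ->
  B !=set0 -> (affdim B < affdim P)%N.
Proof.
move=> [c [d [c_le F_def]]] F_neq E_free embB embF [b0 Bb0].
have [z Pz cz] : exists2 z, P z & dotp c z != d.
  apply: contrapT => none; apply: F_neq; rewrite F_def; apply/seteqP; split=> x;
    first by case.
  by move=> Px; split=> //; apply: contrapT => /eqP cx; apply: none; exists x.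
have FP x : F x -> P x /\ dotp c x = d by rewrite F_def.
have dotpB x y : dotp c (x - y) = dotp c x - dotp c y.
  by rewrite -scaleN1r dotpD dotpZ mulN1r.
have dotp0 : dotp c 0 = 0 by rewrite /dotp big1 // => i _; rewrite mxE mulr0.
have lin k (f : 'I_k -> 'rV[R]_n) (v : 'I_k -> R) :
    dotp c (\sum_i v i *: f i) = \sum_i v i * dotp c (f i).
  elim/big_ind2: _ => [|x u y v' <- <-|i _]; rewrite ?dotpD ?dotpZ //.
have step k (p : 'I_k.+1 -> 'rV[R]_m) : (forall i, B (p i)) ->
    row_free (\matrix_(i < k) (p (lift ord0 i) - p ord0)) -> (k < affdim P)%N.
  move=> Bp p_free.
  pose p' (i : 'I_k.+2) := if (i < k.+1)%N then emb (p (inord i)) else z.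
  pose M := \matrix_(i < k.+1) (p' (lift ord0 i) - p' ord0).
  have p'0 : p' ord0 = emb (p ord0) by rewrite /p' /=; congr (emb (p _));
    apply/val_inj; rewrite /= inordK.
  have p'S (i : 'I_k) : p' (lift ord0 (widen_ord (leqnSn k) i)) =
    emb (p (lift ord0 i)).
    rewrite /p' lift0 /= ltnS ltn_ord; congr (emb (p _)); apply/val_inj.
    by rewrite /= inordK ?ltnS ?ltn_ord // lift0.
  have p'm : p' (lift ord0 ord_max) = z by rewrite /p' lift0 /= ltnn.
  have M_free : row_free M.
    apply: inj_row_free => v; rewrite mulmx_sum_row big_ord_recr /= rowK p'm p'0.
    under eq_bigr => i _ do rewrite rowK p'S p'0 embB.
    (* [dotp c] vanishes on differences of points of the face but not on the last row, so the
       coefficient of that row is 0. *)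
    move=> v0; have := congr1 (dotp c) v0.
    rewrite dotpD lin dotpZ dotpB big1 ?add0r => [|i _]; last first.
      by rewrite -embB dotpB !(FP _ (embF _ (Bp _))).2 subrr mulr0.
    rewrite (FP _ (embF _ (Bp ord0))).2 dotp0 => /eqP;
      rewrite mulf_eq0 subr_eq0 (negPf cz) orbF => /eqP v_max.
    move: v0; rewrite v_max scale0r addr0.
    pose v' : 'rV[R]_k := \row_i v 0 (widen_ord (leqnSn k) i).
    have -> : \sum_(i < k) v 0 (widen_ord (leqnSn k) i) *:
      ((p (lift ord0 i) - p ord0) *m E) =
        v' *m (\matrix_(i < k) (p (lift ord0 i) - p ord0)) *m E.
      rewrite (mulmx_sum_row v') mulmx_suml; apply: eq_bigr => i _.
      by rewrite rowK mxE scalemxAl.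
    rewrite -[X in _ = X](mul0mx _ E) => /(row_free_inj E_free).
    rewrite -[X in _ = X](mul0mx _ (\matrix_(i < k) (p (lift ord0 i) - p ord0))).
    move=> /(row_free_inj p_free) v'0; apply/rowP=> i; rewrite [RHS]mxE.
    have [j ->|->] := unliftP ord_max i; last exact: v_max.
    have := congr1 (fun x : 'rV[R]_k => x 0 j) v'0; rewrite !mxE => <-;
      congr (v 0 _).
    by apply/ord_inj; rewrite lift_max.
  have lt_kn : (k.+1 < n.+1)%N by rewrite ltnS -(eqP M_free) rank_leq_col.
  apply: (@bigop.leq_bigmax_cond _ _ (fun i : 'I_n.+1 =>
    nat_of_ord i) (Ordinal lt_kn)).
  apply/asboolP; exists p'; split=> //= i; rewrite /p'; case: ifP => // _.
  by have [] := FP _ (embF _ (Bp (inord i))).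
have P_gt0 : (0 < affdim P)%N.
  apply: (step 0%N (fun=> b0)) => //; apply: inj_row_free => v _.
  by rewrite [v]thinmx0.
rewrite -(prednK P_gt0) ltnS; apply/bigop.bigmax_leqP => k /asboolP[p [Bp p_free]].
by rewrite -ltnS (prednK P_gt0); exact: step p_free.
Qed.

(** Fixing the other coordinates at those of a point [x0] of the face embeds factor [j] into it. *)
Lemma affdim_factor_lt (n k : nat) (m : 'I_k ->
  nat) (sigma : {j : 'I_k & 'I_(m j)} -> 'I_n)
    (Q : forall j, set 'rV[R]_(m j)) (P : set 'rV[R]_n) (j : 'I_k) :
  injective sigma -> let F := permuted_product sigma Q in
  face P F -> F !=set0 -> F <> P -> (affdim (Q j) < affdim P)%N.
Proof.
move=> sigma_inj F F_face [x0 Fx0] F_neq.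
pose sg (e : 'I_(m j)) := sigma (existT _ j e).
have sg_inj e e' : (sg e == sg e') = (e == e').
  by rewrite (inj_eq sigma_inj) -[existT _ j e]/(Tagged (fun j =>
    'I_(m j)) e) eq_Tagged.
pose E : 'M[R]_(m j, n) := \matrix_(e, i) (sg e == i)%:R.
pose x1 : 'rV[R]_n := \row_i (if [exists e, sg e == i] then 0 else x0 0 i).
pose emb y := x1 + y *m E.
have mulE (y : 'rV[R]_(m j)) e : (y *m E) 0 (sg e) = y 0 e.
  rewrite mxE (bigD1 e) //= big1 ?addr0 ?mxE ?eqxx ?mulr1 // => e' neq.
  by rewrite mxE sg_inj (negPf neq) mulr0.
apply: (@affdim_face_lt _ _ _ _ F emb E) => //.
- by apply: inj_row_free => v vE; apply/rowP=> e; rewrite -mulE vE !mxE.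
- by move=> x y; rewrite /emb mulmxBl opprD addrACA subrr add0r.
- move=> y Qy j'; have [eq_j|neq_j] := eqVneq j' j.
    subst j'; suff -> : \row_e emb y 0 (sigma (existT _ j e)) = y by [].
    apply/rowP=> e; rewrite mxE /emb [(x1 + _) _ _]mxE mulE [x1 _ _]mxE.
    by case: existsP => [_|[]]; [rewrite add0r|exists e].
  suff -> : \row_e emb y 0 (sigma (existT _ j' e)) =
            \row_e x0 0 (sigma (existT _ j' e)) by exact: Fx0.
  have neq_sg e e' : (sg e' == sigma (existT _ j' e)) = false.
    by apply: contra_neqF neq_j => /eqP/sigma_inj/(congr1 (@projT1 _ _)).
  apply/rowP=> e; rewrite !mxE; case: existsP => [[e']|_]; first by rewrite neq_sg.
  by rewrite big1 ?addr0 // => e' _; rewrite mxE neq_sg mulr0.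
by exists (\row_e x0 0 (sigma (existT _ j e))); exact: Fx0.
Qed.

End AffineDimension.

(** * Faces as products of Loday polytopes *)

Section FaceProduct.
Variables (R : realType) (n : nat) (t : PT n.+1) (w : 'I_n.+1 -> int).
Hypothesis w_gt0 : forall v, 0 < w v.
Implicit Types (N S : {set 'I_n}) (NN : {set {set 'I_n}}) (x y z : 'rV[R]_n).

Local Notation pw S := ((path_weight t w S)%:~R : R).
Local Notation P := (loday R t w).
Local Notation tight := (is_tight t w).
Local Notation tight_face := (@tight_face R n t w).

(** Supermodularity squeezes the inequalities of the union and of the intersection to equalities. *)
Lemma tight_setU x S1 S2 : P x -> tight x S1 -> tight x S2 ->
  tight x (S1 :|: S2)%SET.
Proof.
move=> Px /eqP t1 /eqP t2; rewrite /tight eq_le loday_ge // andbT.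
have := path_weight_supermodular t w_gt0 S1 S2; rewrite -(ler_int R) !intrD.
have := loday_ge w_gt0 (S1 :&: S2)%SET Px; have := coord_sumUI S1 S2 x; lra.
Qed.

Lemma tight_inner_edges x NN N : nesting t NN -> N \in NN -> tight_face NN x ->
  tight x (N :\: own_edges NN N)%SET.
Proof.
move=> NN_nesting NN_N [Px x_tight]; rewrite (inner_edgesE NN_nesting NN_N).
elim/big_ind: _ => [|S1 S2|N' /andP[NN_N' _]]; last exact: x_tight.
  by rewrite /tight path_weight_set0 coord_sum0 mulr0.
exact: tight_setU.
Qed.

Lemma coord_sum_own x NN S : nesting t NN ->
  coord_sum S x = \sum_(N in NN) coord_sum (S :&: own_edges NN N)%SET x.
Proof.
move=> NN_nesting; rewrite /coord_sum (partition_big (min_nest NN) (fun N =>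
  N \in NN)) /=.
  by apply: eq_bigr => N NN_N; apply: eq_bigl => i; rewrite !inE.
by move=> i _; exact: min_nest_in NN_nesting.
Qed.

Lemma coord_sum_disjU x S1 S2 : [disjoint S1 & S2]%B ->
  coord_sum (S1 :|: S2)%SET x = coord_sum S1 x + coord_sum S2 x.
Proof.
rewrite -setI_eq0 => /eqP dis; have := coord_sumUI S1 S2 x.
by rewrite dis coord_sum0 addr0.
Qed.

Section Decomposition.
Variables (NN : {set {set 'I_n}}) (NN_nesting : nesting t NN).
Local Notation own := (own_edges NN).
Local Notation inner N := (N :\: own N)%SET.

(** For each nest of [NN], the base polytope of [path_weight] contracted by the inner edges, in the
    coordinates [own N]. *)
Definition layer_ineqs x := forall N, N \in NN ->
  [/\ 2 * coord_sum (own N) x = pw N - pw (inner N)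
    & forall S, S \subset own N ->
        pw (S :|: inner N)%SET - pw (inner N) <= 2 * coord_sum S x].

Lemma own_disj S N : S \subset own N -> [disjoint S & inner N]%B.
Proof.
move=> SN; rewrite -setI_eq0 -finset.subset0; apply/fintype.subsetP=> i;
  rewrite finset.in_setI finset.in_setD.
by case/andP=> /(fintype.subsetP SN) ->.
Qed.

Lemma own_inner N : (own N :|: inner N)%SET = N.
Proof. by rewrite -{1}(finset.setIidPr (own_edges_sub NN N)) finset.setID. Qed.

(** On the face, subtract the equality of [inner N], which is tight as a union of nests. Conversely,
    adding the layer inequalities bounds every coordinate sum by [path_weight_layers]; for the
    equalities, compare with a point [x0] of the face, which has the same sum over each layer and
    hence over each union of layers. *)
Lemma layer_ineqs_tight_face x : layer_ineqs x <-> tight_face NN x.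
Proof.
have to_layers y : tight_face NN y -> layer_ineqs y.
  move=> Fy N NN_N; have [Py /(_ _ NN_N)/eqP yN] := Fy.
  have /eqP yC := tight_inner_edges NN_nesting NN_N Fy; split=> [|S SN].
    rewrite -yN -yC -{2}(own_inner N) coord_sum_disjU ?own_disj //; lra.
  have := loday_ge w_gt0 (S :|: inner N)%SET Py.
  by rewrite coord_sum_disjU ?own_disj // mulrDr yC; lra.
split=> [x_lay|]; last exact: to_layers.
have [x0 Fx0] := tight_face_neq0 R w NN_nesting.
have x0_lay := to_layers _ Fx0.
have own_eq N : N \in NN -> coord_sum (own N) x = coord_sum (own N) x0.
  by move=> NN_N; have [] := x_lay _ NN_N; have [] := x0_lay _ NN_N; lra.
have sat_eq S : (forall i, i \in S -> own (min_nest NN i) \subset S) ->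
    coord_sum S x = coord_sum S x0.
  move=> S_sat; rewrite !(coord_sum_own _ _ NN_nesting); apply: eq_bigr => N NN_N.
  have [->|/set0Pn[i /setIP[iS]]] := eqVneq (S :&: own N)%SET finset.set0.
    by rewrite !coord_sum0.
  rewrite inE => /eqP def_N; have := S_sat _ iS;
    rewrite def_N => /finset.setIidPr->.
  exact: own_eq.
have tot_eq : coord_sum [set: 'I_n]%SET x = coord_sum [set: 'I_n]%SET x0.
  by apply: sat_eq => i _; exact: finset.subsetT.
have x_ge S : pw S <= 2 * coord_sum S x.
  rewrite (coord_sum_own _ _ NN_nesting) big_distrr /=.
  apply: le_trans (_ : \sum_(N in NN) (pw (S :&: own N :|:
    inner N)%SET - pw (inner N)) <= _).
    under eq_bigr do rewrite -intrB; rewrite -rmorph_sum ler_int.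
    exact: path_weight_layers.
  apply: ler_sum => N NN_N; have [_ ge] := x_lay _ NN_N; apply: ge;
    exact: finset.subsetIr.
have x_tight N : N \in NN -> tight x N.
  move=> NN_N; rewrite /tight sat_eq => [|i iN]; first by case: Fx0 => _; exact.
  by apply: fintype.subset_trans (own_edges_sub _ _) _; exact: min_nest_sub.
split=> //; apply: nest_ineqs_loday => //; split=> [|N _]; last exact: x_ge.
by rewrite /tight tot_eq; apply: loday_total; case: Fx0.
Qed.

(** [path_weight_contraction] turns the inequalities of a layer into those of the Loday polytope of
    a contracted tree; the layers partition the edges, so the coordinate maps glue to a
    bijection. *)
Lemma tight_face_product :
  exists (k : nat) (m : 'I_k -> nat) (s : forall j, PT (m j).+1)
         (a : forall j, 'I_(m j).+1 -> int) (sigma : {j : 'I_k & 'I_(m j)} -> 'I_n),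
    [/\ forall j v, 0 < a j v, bijective sigma
      & tight_face NN = permuted_product sigma (fun j => loday R (s j) (a j))].
Proof.
pose Nj (j : 'I_#|NN|) := enum_val j;
  have Nj_in j : Nj j \in NN by exact: enum_valP.
pose m j := #|own (Nj j)|.
have pieces j : exists u : PT (m j).+1 * ('I_(m j) -> 'I_n) * ('I_(m j).+1 -> int),
    [/\ injective u.1.2, [set u.1.2 i | i : 'I_(m j)]%SET =
      own (Nj j), forall b, 0 < u.2 b
      & forall S : {set 'I_(m j)}, path_weight u.1.1 u.2 S =
          path_weight t w (u.1.2 @: S :|:
            inner (Nj j))%SET - path_weight t w (inner (Nj j))].
  have /nestingP[/(_ _ (Nj_in j)) N_nest _ _ _] := NN_nesting.
  have [s [sg [a H]]] := path_weight_contraction w_gt0 N_nest (own_edges_sub _ _)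
    (own_edges_neq0 NN_nesting (Nj_in j)).
  by exists (s, sg, a).
have [u uP] := fin_all_exists pieces.
pose sg j := (u j).1.2.
have sg_inj j : injective (sg j) by case: (uP j).
have sg_img j : [set sg j i | i : 'I_(m j)]%SET = own (Nj j) by case: (uP j).
have a_gt0 j b : 0 < (u j).2 b by case: (uP j) => _ _ pos _; exact: pos.
have pwE j (S : {set 'I_(m j)}) : path_weight (u j).1.1 (u j).2 S =
    path_weight t w (sg j @: S :|:
      inner (Nj j))%SET - path_weight t w (inner (Nj j)).
  by case: (uP j).
pose sigma (je : {j : 'I_#|NN| & 'I_(m j)}) := sg (tag je) (tagged je).
have min_sg j e : min_nest NN (sg j e) = Nj j.
  have : sg j e \in own (Nj j) by rewrite -sg_img imset_f.
  by rewrite inE => /eqP.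
have sigma_inj : injective sigma.
  move=> [j e] [j' e']; rewrite /sigma /= => eq_sg.
  have eq_j : j = j' by apply: enum_val_inj; apply: etrans (esym (min_sg j e)) _;
    rewrite eq_sg min_sg.
  by subst j'; rewrite (sg_inj _ _ _ eq_sg).
have sigma_surj i : exists je, sigma je = i.
  have N_in := min_nest_in i NN_nesting;
    pose j := enum_rank_in N_in (min_nest NN i).
  have : i \in own (Nj j) by rewrite inE /Nj enum_rankK_in.
  by rewrite -sg_img => /imsetP[e _ ->]; exists (existT _ j e).
have [inv invK] := fin_all_exists sigma_surj.
exists #|NN|, m, (fun j => (u j).1.1), (fun j => (u j).2), sigma; split=> //.
  exists inv => //; apply: inj_can_sym => //; exact: can_inj invK.
have rowE (x : 'rV[R]_n) j (S : {set 'I_(m j)}) :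
    coord_sum S (\row_e x 0 (sigma (existT _ j e))) = coord_sum (sg j @: S)%SET x.
  rewrite /coord_sum big_imset => [|e e' _ _]; last exact: sg_inj.
  by apply: eq_bigr => e _; rewrite mxE.
have sg_imgT j : (sg j @: [set: 'I_(m j)])%SET = own (Nj j).
  by rewrite -sg_img; apply/setP=> i; apply/imsetP/imsetP => -[e _ ->]; exists e.
apply/seteqP; split=> x.
  move/layer_ineqs_tight_face=> x_lay j; have [x_tot x_ge] := x_lay _ (Nj_in j).
  apply: nest_ineqs_loday => //; split=> [|S _].
    by rewrite /is_tight rowE pwE sg_imgT own_inner x_tot intrB.
  rewrite rowE pwE intrB x_ge // -sg_imgT; apply/imsetS/finset.subsetT.
move=> x_prod; apply/layer_ineqs_tight_face => N NN_N.
pose j := enum_rank_in NN_N N; have def_N : Nj j = N by rewrite /Nj enum_rankK_in.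
have x_j := x_prod j; split.
  have /eqP := loday_total x_j; rewrite rowE pwE sg_imgT own_inner def_N intrB //.
move=> S SN; pose T := (sg j @^-1: S)%SET.
have def_S : (sg j @: T)%SET = S.
  apply/setP=> i; apply/imsetP/idP => [[e]|iS]; first by rewrite inE => ? ->.
  have /imsetP[e _ def_i] : i \in [set sg j e | e : 'I_(m j)]%SET.
    by rewrite sg_img def_N (fintype.subsetP SN).
  by exists e; rewrite // inE -def_i.
have := loday_ge (a_gt0 j) T x_j; by rewrite rowE pwE def_S def_N intrB.
Qed.

End Decomposition.

End FaceProduct.

Theorem proposition2p15 (R : realType) (n : nat) (t : PT n.+1)
    (w : 'I_n.+1 -> int) (w_gt0 : forall v, 0 < w v) :
  [/\ loday R t w `<=` hyperplane R w,
      forall N : {set 'I_n}, nontrivial_nest t N ->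
        forall NN : {set {set 'I_n}}, maximal_nesting t NN ->
          halfspace R t w N (nesting_point R t w NN) /\
          (boundary R t w N (nesting_point R t w NN) <-> N \in NN),
      loday R t w =
        hyperplane R w `&`
        \bigcap_(N in [set N | nontrivial_nest t N]) halfspace R t w N,
      exists f : nesting_lattice t -> set 'rV[R]_n,
        set_bij [set: nesting_lattice t] (face (loday R t w)) f /\
        (forall x y, f x `<=` f y <-> nesting_le y x)
    & forall F : set 'rV[R]_n, face (loday R t w) F -> F !=set0 ->
        exists (k : nat) (m : 'I_k -> nat) (s : forall j, PT (m j).+1)
               (a : forall j, 'I_(m j).+1 -> int)
               (sigma : {j : 'I_k & 'I_(m j)} -> 'I_n),
          [/\ forall j v, 0 < a j v,
              bijective sigma,
              F = permuted_product sigma (fun j => loday R (s j) (a j))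
            & F <> loday R t w ->
              forall j, (affdim (loday R (s j) (a j)) < affdim (loday R t w))%N]].
Proof.
split.
- by move=> x /loday_total x_tot; apply/(hyperplaneE t).
- move=> N /andP[N_nest _] NN NN_max; split; last first.
    by rewrite boundaryE // tight_point_nest.
  apply/(halfspaceE _ _ N_nest); apply: loday_ge => //. exact: loday_point.
- by apply/seteqP; split=> x; rewrite -nest_ineqs_halfspaces;
    [exact: loday_nest_ineqs|exact: nest_ineqs_loday].
- exact: loday_face_lattice.
move=> F F_face F_neq0; have [NN NN_nesting def_F] :=
  loday_face_tight w_gt0 F_face F_neq0.
have [k [m [s [a [sigma [a_gt0 sigma_bij F_prod]]]]]] :=
  tight_face_product R w_gt0 NN_nesting.
rewrite -def_F in F_prod; exists k, m, s, a, sigma; split=> // F_neq j.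
rewrite F_prod in F_face F_neq0 F_neq.
exact: affdim_factor_lt (bij_inj sigma_bij) F_face F_neq0 F_neq.
Qed.
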